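(* Let $d\geq 2$. There exist constants $c_d, a_d, A_d>0$ depending only on $d$ such that for every real $K\geq 1$ there exist a finitely supported probability measure $\nu$ on $\mathbb{R}^d$, with support $\mathcal{Y}$, and a Borel probability measure $\mu$ on $\mathbb{R}^d$ with finite first moment, such that: (a) $a_d K\leq K_{\mu,\nu}\leq A_d K$; (b) there exists a coupling $\gamma\in\Gamma(\mu,\nu)$ with $\|x-y\|=d(x,\mathcal{Y})$ for $\gamma$-a.e. $(x,y)$; (c) $$W_1(\mu,\nu)\geq c_d\,\frac{K}{(\log(K+1))^d}\,SW_{1,1}(\mu,\nu).$$
   Context: $\|\cdot\|$ is the Euclidean norm, $d(x,\mathcal{Y}) := \min_{y\in\mathcal{Y}}\|x-y\|$, and $\Gamma(\mu,\nu)$ is the set of couplings of $\mu$ and $\nu$. $W_1(\mu,\nu) := \inf_{\gamma\in\Gamma(\mu,\nu)}\int\|x-y\|\,d\gamma(x,y)$ (on $\mathbb{R}^d$ or on $\mathbb{R}$). The sliced 1-Wasserstein distance is $SW_{1,1}(\mu,\nu) := \int_{\mathbb{S}^{d-1}} W_1(\theta_\#\mu,\theta_\#\nu)\,d\sigma_d(\theta)$, where $\theta_\#\mu$ is the pushforward of $\mu$ under $x\mapsto\langle\theta,x\rangle$ and $\sigma_d$ is the uniform probability measure on $\mathbb{S}^{d-1}$. The complexity parameter is $$K_{\mu,\nu} := \operatorname*{ess\,sup}_{x\sim\mu,\; x\notin\mathcal{Y}} \; d(x,\mathcal{Y})\sum_{y\in\mathcal{Y}}\frac{1}{\|x-y\|},$$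 (the $\mu$-essential supremum over $x\notin\mathcal{Y}$), with the convention $K_{\mu,\nu}:=1$ if $\mu(\mathcal{Y})=1$. *)

(* Defs.v *)
From HB Require Import structures.
From mathcomp Require Import all_boot all_order all_algebra.
From mathcomp Require Import all_classical all_reals all_analysis.
From mathcomp Require Import measurable_realfun ess_sup_inf.

Set Implicit Arguments.
Unset Strict Implicit.
Unset Printing Implicit Defensive.

Import Order.TTheory GRing.Theory Num.Theory.
Import numFieldNormedType.Exports.

Local Open Scope classical_set_scope.
Local Open Scope ring_scope.

Section borel_matrix.
Context (R : realType) (m n : nat).

HB.instance Definition _ :=
  @isMeasurable.Build (sigma_display (@open 'M[R]_(m, n))) 'M[R]_(m, n)
    <<s (@open 'M[R]_(m, n)) >> (@sigma_algebra0 _ setT _)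
    (@sigma_algebraC _ _) (@sigma_algebra_bigcup _ setT _).

Lemma measurable_mxE :
  @measurable _ 'M[R]_(m, n) = <<s (@open 'M[R]_(m, n)) >>.
Proof. by []. Qed.

Lemma measurable_coord i j :
  measurable_fun [set: 'M[R]_(m, n)] (fun M : 'M[R]_(m, n) => M i j).
Proof.
apply: (measurability _ (RGenOpens.measurableE R)) => _ [_ [a [b ->]] <-].
rewrite setTI; apply: sub_sigma_algebra.
by move: (@coord_continuous R m n i j) => /continuousP; apply; exact: interval_open.
Qed.

End borel_matrix.

Section measurable_mx.
Context d (T : measurableType d) (R : realType) (m n : nat).

Lemma measurable_fun_mx (f : T -> 'M[R]_(m, n)) :
  (forall i j, measurable_fun [set: T] (fun x => f x i j)) ->
  measurable_fun [set: T] f.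
Proof.
move=> mf; apply: (measurability _ (measurable_mxE R m n)) => _ [U Uo <-].
rewrite setTI.
pose box (q : 'M[rat]_(m, n) * rat) : set 'M[R]_(m, n) :=
  [set M | forall i j, ball (ratr (q.1 i j) : R) (ratr q.2) (M i j)].
pose F q := [set x | box q `<=` U /\ box q (f x)].
have -> : f @^-1` U = \bigcup_q F q.
  apply/seteqP; split => [x /= Ufx|x [q _ [qU]] /qU//].
  have /nbhs_ballP[e /= e0 eU] : nbhs (f x) U by apply: open_nbhs_nbhs.
  have /rat_in_itvoo[r /itvP re] : (0 : R) < e / 2 by rewrite divr_gt0.
  have r0 : (0 : R) < ratr r by rewrite re.
  have /choice[k kP] : forall ij : 'I_m * 'I_n, exists q : rat,
      ball (ratr q : R) (ratr r) (f x ij.1 ij.2).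
    move=> [i j] /=.
    have /rat_in_itvoo[q /itvP qP] : f x i j - ratr r < f x i j + ratr r.
      by rewrite ltrD2l gtrN.
    by exists q; apply: ball_sym; rewrite /ball/= ltr_distlC !qP.
  exists (\matrix_(i, j) k (i, j), r) => //; split => /=; last first.
    by move=> i j; rewrite mxE; exact: (kP (i, j)).
  move=> M /= kM; apply: eU; split => // i j.
  apply: (@le_ball _ _ _ (ratr r + ratr r)).
    by rewrite (splitr e) lerD// ltW// re.
  apply: (@ball_triangle R R (ratr (k (i, j)))).
    by apply: ball_sym; exact: (kP (i, j)).
  by have := kM i j; rewrite mxE.
apply: countable_bigcupT_measurable; first exact: countableP; move=> q.
have [qU|qU] := pselect (box q `<=` U); last first.
  by rewrite (_ : F q = set0)// -subset0 => x [].
rewrite (_ : F q = \bigcap_ij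
    ((fun x => f x ij.1 ij.2) @^-1` ball (ratr (q.1 ij.1 ij.2) : R) (ratr q.2))).
  apply: fin_bigcap_measurable => // -[i j] _.
  by rewrite -[X in measurable X]setTI; apply: mf => //; exact: measurable_ball.
apply/seteqP; split => [x [_ qx] [i j] _|x qx]; first exact: qx.
by split => // i j; exact: (qx (i, j)).
Qed.

End measurable_mx.

Section rVcons.
Context (R : realType) (n : nat).

Definition rVcons (p : R * 'rV[R]_n) : 'rV[R]_n.+1 :=
  \row_i oapp (p.2 ord0) p.1 (unlift ord0 i).

Definition rVuncons (v : 'rV[R]_n.+1) : R * 'rV[R]_n :=
  (v ord0 ord0, \row_i v ord0 (lift ord0 i)).

Lemma rVconsK : cancel rVcons rVuncons.
Proof.
move=> [t v]; rewrite /rVuncons mxE unlift_none/=; congr pair.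
by apply/rowP => i; rewrite !mxE liftK.
Qed.

Lemma rVunconsK : cancel rVuncons rVcons.
Proof.
by move=> v; apply/rowP => i; rewrite mxE; case: unliftP => [j|] ->//=; rewrite mxE.
Qed.

Lemma measurable_rVcons : measurable_fun [set: R * 'rV[R]_n] rVcons.
Proof.
apply: measurable_fun_mx => i j; rewrite (ord1 i).
under eq_fun do rewrite mxE.
case: unliftP => [k|] _ /=; last exact: measurable_fst.
exact: (measurableT_comp (@measurable_coord R 1 n ord0 k)).
Qed.

Lemma measurable_rVuncons : measurable_fun [set: 'rV[R]_n.+1] rVuncons.
Proof.
apply: measurable_fun_pair; first exact: measurable_coord.
apply: measurable_fun_mx => i j; under eq_fun do rewrite mxE.
exact: measurable_coord.
Qed.

End rVcons.

Section lebesgue_rV_step.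
Context (R : realType) (n : nat).
Variable mu : {sigma_finite_measure set 'rV[R]_n -> \bar R}.

Definition lebesgue_rV_step : set 'rV[R]_n.+1 -> \bar R :=
  pushforward (lebesgue_measure \x mu)%E (@rVcons R n).


Let nu : {measure set 'rV[R]_n.+1 -> \bar R} :=
  measure_function_pushforward__canonical__measure_function_Measure
    (lebesgue_measure \x mu)%E (@measurable_rVcons R n).

Let step0 : lebesgue_rV_step set0 = 0%E.
Proof. exact: (measure0 nu). Qed.

Let step_ge0 A : (0 <= lebesgue_rV_step A)%E.
Proof. exact: (measure_ge0 nu). Qed.

Let step_sigma_additive : semi_sigma_additive lebesgue_rV_step.
Proof. exact: (@measure_semi_sigma_additive _ _ _ nu). Qed.

HB.instance Definition _ := isMeasure.Build _ _ _ lebesgue_rV_step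
  step0 step_ge0 step_sigma_additive.

Let step_sigma_finite : sigma_finite setT lebesgue_rV_step.
Proof.
have /sigma_finiteP[F [FT ndF Foo]] := sigma_finiteT (@lebesgue_measure R).
have /sigma_finiteP[G [GT ndG Goo]] := sigma_finiteT mu.
exists (fun i => @rVuncons R n @^-1` (F i `*` G i)) => [|i].
  apply/esym; rewrite -subTset => v _.
  have [k _ Fk] : (\bigcup_i F i) (rVuncons v).1 by rewrite -FT.
  have [l _ Gl] : (\bigcup_i G i) (rVuncons v).2 by rewrite -GT.
  exists (maxn k l) => //; split.
    by move: Fk; exact/subsetPset/ndF/leq_maxl.
  by move: Gl; exact/subsetPset/ndG/leq_maxr.
have [mF Fi] := Foo i; have [mG Gi] := Goo i; split.
  rewrite -[X in measurable X]setTI; apply: measurable_rVuncons => //.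
  exact: measurableX.
rewrite /lebesgue_rV_step /pushforward -comp_preimage.
rewrite (_ : _ \o _ = id) ?preimage_id//.
  by rewrite product_measure1E// lte_mul_pinfty// ge0_fin_numE.
by apply/funext => p; exact: rVconsK.
Qed.

HB.instance Definition _ := Measure_isSigmaFinite.Build _ _ _ lebesgue_rV_step
  step_sigma_finite.

End lebesgue_rV_step.

Fixpoint lebesgue_rV (R : realType) (n : nat) :
    {sigma_finite_measure set 'rV[R]_n -> \bar R} :=
  if n is n'.+1 then lebesgue_rV_step (lebesgue_rV R n') else \d_(0 : 'rV[R]_0).

Section euclidean.
Context (R : realType) (n : nat).
Implicit Types u v : 'rV[R]_n.

Definition inner u v : R := \sum_i u ord0 i * v ord0 i.

(* The norm [`|v|] of the library on ['rV[R]_n] is the sup norm. *)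
Definition enorm v : R := Num.sqrt (inner v v).

Definition unit_sphere : set 'rV[R]_n := [set v | enorm v = 1].

Definition unit_ball : set 'rV[R]_n := [set v | enorm v <= 1].

Definition direction v : 'rV[R]_n := (enorm v)^-1 *: v.

Lemma measurable_inner u : measurable_fun setT (inner u).
Proof.
apply: measurable_sum => i; apply: measurable_funM => //.
exact: measurable_coord.
Qed.

Lemma measurable_enorm : measurable_fun setT enorm.
Proof.
apply: measurableT_comp.
  by apply: continuous_measurable_fun; exact: sqrt_continuous.
by apply: measurable_sum => i; apply: measurable_funM; exact: measurable_coord.
Qed.

Lemma measurable_unit_ball : measurable unit_ball.
Proof.
rewrite (_ : unit_ball = enorm @^-1` `]-oo, 1]).
  by rewrite -[X in measurable X]setTI; apply: measurable_enorm.
by apply/seteqP; split => v /=; rewrite in_itv.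
Qed.

Lemma measurable_unit_sphere : measurable unit_sphere.
Proof.
rewrite (_ : unit_sphere = enorm @^-1` [set 1])//.
by rewrite -[X in measurable X]setTI; apply: measurable_enorm.
Qed.

Lemma measurable_direction : measurable_fun setT direction.
Proof.
have mV : measurable_fun setT (fun v => (enorm v)^-1).
  rewrite (_ : (fun v => _) = (@powR R ^~ (- 1)) \o enorm).
    apply: measurableT_comp measurable_enorm; exact: measurable_powR.
  by apply/funext => v /=; rewrite powR_inv1// sqrtr_ge0.
apply: measurable_fun_mx => i j.
rewrite (_ : (fun v => _) = (fun v => (enorm v)^-1) \* (fun v => v i j)).
  by apply: measurable_funM => //; exact: measurable_coord.
by apply/funext => v; rewrite mxE.
Qed.

HB.instance Definition _ :=
  isMeasurableFun.Build _ _ _ _ direction measurable_direction.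

Lemma inner_ge0 v : 0 <= inner v v.
Proof. by apply: sumr_ge0 => i _; rewrite -expr2 sqr_ge0. Qed.

Lemma enorm_le1 v : (enorm v <= 1) = (inner v v <= 1).
Proof. by rewrite -{1}(sqrtr1 R) ler_sqrt. Qed.

Lemma enorm_eq0 v : enorm v = 0 -> v = 0.
Proof.
move/eqP; rewrite sqrtr_eq0 => v0; apply/rowP => i; rewrite mxE.
have /eqP : inner v v = 0 by apply/eqP; rewrite eq_le v0 inner_ge0.
rewrite psumr_eq0 => [/allP/(_ i (mem_index_enum _))|j _].
  by rewrite /= mulf_eq0 orbb => /eqP.
by rewrite -expr2 sqr_ge0.
Qed.

Lemma enorm_direction v : v != 0 -> enorm (direction v) = 1.
Proof.
move=> v0; have n0 : enorm v != 0 by apply: contra_neq v0; exact: enorm_eq0.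
rewrite /enorm /inner.
under eq_bigr do rewrite !mxE mulrACA.
rewrite -mulr_sumr sqrtrM ?sqr_ge0 -?expr2 ?sqr_ge0// sqrtr_sqr.
by rewrite ger0_norm ?invr_ge0 ?sqrtr_ge0// mulVf.
Qed.

(* The law of [x / |x|] for [x] uniformly distributed in the unit ball, that is
   the normalised cone measure [A |-> vol {r a | 0 < r <= 1, a \in A} / vol B].
   The dirac mass is only the default value required by [mnormalize] for
   measures of total mass 0 or oo; see [lebesgue_unit_ball_gt0] and
   [lebesgue_unit_ball_lty] below. *)
Definition sphere_unif : probability 'rV[R]_n R :=
  distribution
    (mnormalize (mrestr (lebesgue_rV R n) measurable_unit_ball) \d_(0 : 'rV[R]_n))
    direction.

End euclidean.

Arguments unit_sphere : clear implicits.
Arguments unit_ball : clear implicits.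

Section unit_ball_volume.
Context (R : realType).

Let box n (c : R) : set 'rV[R]_n := [set v | forall i, `|v ord0 i| <= c].

Let measurable_box n (c : R) : measurable (@box n c).
Proof.
rewrite (_ : box c = \bigcap_i ((fun v : 'rV[R]_n => v ord0 i) @^-1` `[- c, c])).
  apply: fin_bigcap_measurable => // i _.
  by rewrite -[X in measurable X]setTI; apply: measurable_coord.
apply/seteqP; split => [v vc i _|v vc i] /=.
  by rewrite in_itv/= -ler_norml.
by have := vc i Logic.I; rewrite /= in_itv/= -ler_norml.
Qed.

Let lebesgue_box n (c : R) : 0 <= c ->
  lebesgue_rV R n (box c) = ((c *+ 2) ^+ n)%:E.
Proof.
move=> c0; elim: n => [|n ih] /=.
  by rewrite diracE mem_set// => -[].
rewrite /lebesgue_rV_step /pushforward.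
rewrite (_ : _ @^-1` _ = `[- c, c] `*` box c); last first.
  apply/seteqP; split => [[t v] /= tv|[t v] [/= ]].
    split=> /=; first by have := tv ord0; rewrite mxE unlift_none/= in_itv/= ler_norml.
    by move=> i; have := tv (lift ord0 i); rewrite mxE liftK.
  rewrite in_itv/= -ler_norml => tc vc i; rewrite mxE.
  by case: unliftP => [j|] _ //=; exact: vc.
have mbox := @measurable_box n c.
rewrite product_measure1E//.
rewrite [X in (_ * X)%E]ih /= lebesgue_measure_itv/= lte_fin.
have [->|cn0] := eqVneq c 0; first by rewrite oppr0 ltxx mul0rn mul0e exprS mul0r.
rewrite gtrN ?lt_neqAle 1?eq_sym ?cn0// -EFinD opprK -mulr2n -EFinM.
by rewrite exprS.
Qed.

Lemma lebesgue_unit_ball_lty n : (lebesgue_rV R n (unit_ball R n) < +oo)%E.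
Proof.
apply: (@le_lt_trans _ _ (lebesgue_rV R n (box 1))).
  apply: le_measure; rewrite ?inE; [exact: measurable_unit_ball|exact: measurable_box|].
  move=> v; rewrite /unit_ball /= enorm_le1 => v1 i.
  rewrite -(ler_pXn2r (n := 2)) ?nnegrE// expr1n real_normK ?num_real//.
  apply: le_trans v1; rewrite /inner (bigD1 i)//= -expr2 lerDl.
  by apply: sumr_ge0 => j _; rewrite -expr2 sqr_ge0.
by rewrite lebesgue_box// ltry.
Qed.

Lemma lebesgue_unit_ball_gt0 n : (0 < lebesgue_rV R n (unit_ball R n))%E.
Proof.
pose c : R := n.+1%:R^-1.
have c0 : 0 < c by rewrite invr_gt0.
apply: (@lt_le_trans _ _ (lebesgue_rV R n (box c))).
  by rewrite lebesgue_box ?ltW// lte_fin exprn_gt0// mulrn_wgt0.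
apply: le_measure; rewrite ?inE; [exact: measurable_box|exact: measurable_unit_ball|].
move=> v vc; rewrite /unit_ball /= enorm_le1.
apply: (@le_trans _ _ (\sum_(i < n) c)).
  apply: ler_sum => i _; rewrite -expr2 -real_normK ?num_real// expr2.
  rewrite -[leRHS]mulr1 ler_pM//; apply: le_trans (vc i) _.
  by rewrite invf_le1// ler1n.
rewrite sumr_const card_ord /c -[_ *+ n]mulr_natl ler_pdivrMr//.
by rewrite mul1r ler_nat.
Qed.

Lemma sphere_unif_sphere n : sphere_unif R n.+1 (unit_sphere R n.+1) = 1%E.
Proof.
have box0 : box 0 = [set 0 : 'rV[R]_n.+1].
  apply/seteqP; split => [v v0|v -> i]; last by rewrite mxE normr0.
  by apply/rowP => i; rewrite mxE; apply/eqP; rewrite -normr_le0; exact: v0.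
have mS : measurable (@direction R n.+1 @^-1` unit_sphere R n.+1).
  rewrite -[X in measurable X]setTI; apply: measurable_direction => //.
  exact: measurable_unit_sphere.
pose P : probability 'rV[R]_n.+1 R :=
  mnormalize (mrestr (lebesgue_rV R n.+1) (@measurable_unit_ball R n.+1))
    \d_(0 : 'rV[R]_n.+1).
rewrite [LHS](_ : _ = P (@direction R n.+1 @^-1` unit_sphere R n.+1))//.
suff : P (~` (@direction R n.+1 @^-1` unit_sphere R n.+1)) = 0%E.
  rewrite probability_setC// => /eqP.
  by rewrite sube_eq ?fin_num_measure// add0e => /eqP.
have PB : P (box 0) = 0%E; last first.
  apply: (@subset_measure0 _ _ _ P _ (box 0)) => //; first exact: measurableC.
  rewrite box0 => v /= vS; apply/eqP/negPn/negP => v0.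
  by apply: vS; exact: enorm_direction.
have L0 : lebesgue_rV R n.+1 (box 0 `&` unit_ball R n.+1) = 0%E.
  apply: (@subset_measure0 _ _ _ (lebesgue_rV R n.+1) _ (box 0)) => //.
    by apply: measurableI; [exact: measurable_box|exact: measurable_unit_ball].
  by rewrite [LHS](lebesgue_box n.+1 (lexx 0)) mul0rn expr0n.
have := lebesgue_unit_ball_gt0 n.+1; have := lebesgue_unit_ball_lty n.+1.
rewrite /P; move: L0; move: (lebesgue_rV R n.+1) => L L0 Loo Lgt0.
rewrite /= /mnormalize /= /mrestr setTI gt_eqF//= lt_eqF//=.
by rewrite L0 mul0e.
Qed.

End unit_ball_volume.

Section wasserstein.
Context d (T : measurableType d) (R : realType).

Definition couplings (mu nu : set T -> \bar R) : set (probability (T * T)%type R) :=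
  [set gamma | forall A, measurable A ->
     gamma (A `*` setT) = mu A /\ gamma (setT `*` A) = nu A].

Definition wasserstein1 (dist : T -> T -> R) (mu nu : set T -> \bar R) : \bar R :=
  ereal_inf [set (\int[gamma]_p (dist p.1 p.2)%:E)%E | gamma in couplings mu nu].

End wasserstein.

Section sliced_wasserstein.
Context (R : realType) (n : nat).
Implicit Types mu nu : set 'rV[R]_n -> \bar R.

Definition W1 mu nu : \bar R := wasserstein1 (fun x y : 'rV[R]_n => enorm (x - y)) mu nu.

Definition W1_line (mu nu : set R -> \bar R) : \bar R :=
  wasserstein1 (fun s t : R => `|s - t|) mu nu.

Definition SW11 mu nu : \bar R :=
  (\int[sphere_unif R n]_(theta in unit_sphere R n)
     W1_line (pushforward mu (inner theta)) (pushforward nu (inner theta)))%E.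

End sliced_wasserstein.

Section complexity.
Context (R : realType) (n : nat).
Implicit Types (mu nu : probability 'rV[R]_n R) (x : 'rV[R]_n) (Y : set 'rV[R]_n).

Definition supp nu : set 'rV[R]_n :=
  [set x | forall U, open U -> U x -> (0 < nu U)%E].

Definition finitely_supported nu : Prop :=
  exists2 S : set 'rV[R]_n, finite_set S & nu S = 1%E.

Definition finite_first_moment mu : Prop :=
  (\int[mu]_x (enorm x)%:E < +oo)%E.

(* The infimum is a minimum when [Y] is finite and nonempty. *)
Definition dist_to x Y : R := inf [set enorm (x - y) | y in Y].

(* The value -oo on [supp nu] restricts the essential supremum to the points
   outside [supp nu]. *)
Definition complexity mu nu : \bar R :=
  if mu (supp nu) == 1%E then 1%E else
  ess_sup mu (fun x => if x \in supp nu then -oo%E else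
    (dist_to x (supp nu) * \sum_(y \in supp nu) (enorm (x - y))^-1)%:E).

End complexity.

(* Main.v *)
(* Write n = 2 ^ J for a scale J with K <= n <= 2 K.  The target is the uniform
   measure on the n x n integer grid in a coordinate plane, and the source moves
   every grid point by +1/2 and by -1/2 along one fixed axis.  Every source point
   then lies at distance exactly 1/2 from the grid, so W_1 >= 1/2 and the
   complexity is of order n.

   On the line spanned by v = (b, a, ...), with b along the columns and a along
   the shift axis, the difference of the two distribution functions at t is
   (2 n^2)^-1 times the sum over k < n of a 1-periodic square wave evaluated at
   (t - k b) / a, restricted to the k for which this number lies in
   [-1/2, n - 1/2[, that is, to an interval of k.  Approximating the square wave
   by its Fourier polynomial of degree n^2 leaves geometric sums, the h-th of
   which is at most min(n, |sin(pi h b / a)|^-1) / h up to constants.  The mean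
   of this minimum over the directions v is O(log n), because
   |sin(pi h b / a)| < delta has probability O(delta) uniformly in h; summing
   over h gives SW = O((log n)^2 / n).  Since d >= 2 this is the claimed bound. *)
Require Import Defs.
From mathcomp Require Import all_boot all_order all_algebra.
From mathcomp Require Import all_classical all_reals all_analysis.
From mathcomp Require Import measurable_realfun ess_sup_inf ring lra zify.

Import Order.TTheory GRing.Theory Num.Theory.
Import numFieldNormedType.Exports.

Local Open Scope classical_set_scope.
Local Open Scope ring_scope.

Set Implicit Arguments.
Unset Strict Implicit.
Unset Printing Implicit Defensive.

(** * Trigonometric sums *)

(** Multiplied by [sin (y / 2)], each term becomes half a difference of consecutive cosines, and the
    sum telescopes. *)
Lemma sin_sum_bound (R : realType) (x y : R) p q : (p <= q)%N ->
  `|\sum_(p <= k < q) sin (x + k%:R * y)| * `|sin (y / 2)| <= 1.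
Proof.
move=> pq.
have E k : sin (x + k%:R * y) * sin (y / 2) =
   - (cos (x + k.+1%:R * y - y / 2) / 2) - - (cos (x + k%:R * y - y / 2) / 2).
  rewrite (_ : x + k.+1%:R * y - y / 2 = (x + k%:R * y) + y / 2).
    by rewrite cosB cosD; lra.
  by rewrite -natr1; lra.
rewrite -normrM mulr_suml (eq_bigr _ (fun k _ => E k)) telescope_sumr//.
rewrite opprK.
have := cos_max (x + q%:R * y - y / 2); have := cos_max (x + p%:R * y - y / 2).
rewrite !ler_norml => /andP[? ?] /andP[? ?].
by apply/andP; split; lra.
Qed.
Lemma dirichlet_kernel (R : realType) H (y : R) :
  sin y * (1 + \sum_(h < H) 2 * cos (2 * h.+1%:R * y)) = sin ((2 * H%:R + 1) * y).
Proof.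
elim: H => [|H IH]; first by rewrite big_ord0 addr0 mulr1 mulr0 add0r mul1r.
rewrite big_ord_recr/= addrA mulrDr IH.
rewrite (_ : (2 * H%:R + 1) * y = 2 * H.+1%:R * y - y); last by rewrite -natr1; lra.
rewrite (_ : (2 * H.+1%:R + 1) * y = 2 * H.+1%:R * y + y); last by lra.
by rewrite sinB sinD; lra.
Qed.

(** Partial Fourier sum of the [pi]-periodic sawtooth equal to [pi / 2 - y] on []0, pi[]. Its
    derivative is the Dirichlet kernel minus 1. *)
Definition sin_series (R : realType) H (y : R) : R :=
  \sum_(h < H) sin (2 * h.+1%:R * y) / h.+1%:R.

Lemma is_derive_sin_series (R : realType) H (y : R) :
  is_derive y 1 (sin_series H) (\sum_(h < H) 2 * cos (2 * h.+1%:R * y)).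
Proof.
elim: H => [|H IH].
  rewrite big_ord0 (_ : sin_series 0 = cst 0); first exact: is_derive_cst.
  by apply/funext => z; rewrite /sin_series big_ord0.
rewrite (_ : sin_series H.+1 = sin_series H \+
    (fun z => H.+1%:R^-1 *: sin (2 * H.+1%:R * z))); last first.
  by apply/funext => z; rewrite /sin_series big_ord_recr/= /GRing.scale/= mulrC.
rewrite big_ord_recr/=; apply: is_deriveD.
have D : is_derive y 1 (fun z : R => (2 * H.+1%:R) *: z) (2 * H.+1%:R).
  by apply: is_derive_eq; rewrite /GRing.scale/= mulr1.
have := @is_deriveZ _ _ _ _ H.+1%:R^-1 y 1 _
  (@is_derive1_comp _ _ _ _ _ _ (is_derive_sin _) D).
by move=> /(@is_derive_eq _ _ _ _ _ _); apply; rewrite /GRing.scale/=; field.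
Qed.
Lemma sin_pi_natr (R : realType) (k : nat) : sin (pi *+ k : R) = 0.
Proof. by elim: k => [|k IH]; rewrite ?sin0// mulrSr sinDpi IH oppr0. Qed.
Lemma ndecr_itv0pi (R : realType) (g dg : R -> R) :
  (forall y : R, 0 < y < pi -> is_derive y 1 g (dg y)) ->
  (forall y : R, 0 < y < pi -> 0 <= dg y) ->
  forall x y : R, 0 < x -> x <= y -> y < pi -> g x <= g y.
Proof.
move=> gD dg0 x y x0 xy yp.
have itv (z : R) : z \in `]0, pi[%R -> 0 < z < pi by rewrite in_itv.
apply: (@ger0_derive1_le_oo _ g 0 pi) => //.
- by move=> z /itv zp; exact: (@ex_derive _ _ _ _ _ _ _ (gD z zp)).
- move=> z /itv zp; rewrite derive1E.
  by rewrite (@derive_val _ _ _ _ _ _ _ (gD z zp)) dg0.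
- move=> z; rewrite inE/= => /itv zp; apply: differentiable_continuous.
  by apply/derivable1_diffP; exact: (@ex_derive _ _ _ _ _ _ _ (gD z zp)).
- by rewrite in_itv/= x0 (le_lt_trans xy).
- by rewrite in_itv/= yp (lt_le_trans x0).
Qed.
(* The term divided by [N * sin y] cancels the Dirichlet kernel in the derivative,
   and for [c = 1], [c = -1] what is left has a constant sign. *)
Lemma is_derive_sawtooth_error (R : realType) (H : nat) (c y : R) (N := 2 * H%:R + 1) :
  0 < y < pi ->
  is_derive y 1 (fun y => (pi / 2 - y - sin_series H y)
      - N^-1 * ((cos (N * y) - c * cos y) * (sin y)^-1))
    ((cos (N * y) * cos y - c) / (N * sin y ^+ 2)).
Proof.
move=> yp; have s0 : sin y != 0 by rewrite gt_eqF// sin_gt0_pi.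
have N0 : N != 0 by rewrite gt_eqF// ltr_wpDl// mulr_ge0.
have DN : is_derive y 1 (fun z : R => cos (N * z)) (- N * sin (N * y)).
  have D : is_derive y 1 (fun z : R => N *: z) N.
    by apply: is_derive_eq; rewrite /GRing.scale/= mulr1.
  have := @is_derive1_comp _ _ _ _ _ _ (is_derive_cos _) D.
  by move=> /(@is_derive_eq _ _ _ _ _ _); apply; rewrite /GRing.scale/=; ring.
have DC : is_derive y 1 (fun z : R => cos (N * z) - c * cos z)
    (- N * sin (N * y) + c * sin y).
  have := is_deriveB DN (@is_deriveZ _ _ _ _ c y 1 _ (is_derive_cos y)).
  by move=> /(@is_derive_eq _ _ _ _ _ _); apply; rewrite /GRing.scale/=; ring.
have DV : is_derive y 1 (fun z : R => (sin z)^-1) (- (sin y) ^- 2 *: cos y).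
  exact: is_deriveV.
have De : is_derive y 1 (fun y : R => pi / 2 - y - sin_series H y)
    (- 1 - \sum_(h < H) 2 * cos (2 * h.+1%:R * y)).
  apply: is_deriveB (is_derive_sin_series H y).
  have := is_deriveB (is_derive_cst (pi / 2 : R) y 1) (is_derive_id y (1 : R)).
  by move=> /(@is_derive_eq _ _ _ _ _ _); apply; rewrite sub0r.
have := is_deriveB De (@is_deriveZ _ _ _ _ N^-1 y 1 _ (is_deriveM DC DV)).
move=> /(@is_derive_eq _ _ _ _ _ _); apply.
have := dirichlet_kernel H y; rewrite -/N.
move: (\sum_(h < H) _) => S SE; rewrite /GRing.scale/= -SE.
have := cos2Dsin2 y; move: (sin y) s0 (cos y) (cos (N * y)) => s s0 k l sk.
rewrite -[c in RHS]mulr1 -[1 in RHS]sk; field.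
by rewrite s0 N0.
Qed.

(** The functions [g 1] and [g (-1)] both vanish at [pi / 2] and are monotone in opposite
    directions, so they have opposite signs at every [y]. The error therefore lies between
    [(cos (N y) - cos y) / (N sin y)] and [(cos (N y) + cos y) / (N sin y)]. *)
Lemma sawtooth_approx (R : realType) (H : nat) (y : R) : 0 < y < pi ->
  `|pi / 2 - y - sin_series H y| <= 2 / ((2 * H%:R + 1) * sin y).
Proof.
move=> /andP[y0 yp]; set N := 2 * H%:R + 1.
have N0 : 0 < N by rewrite ltr_wpDl// mulr_ge0.
pose g (c y : R) := (pi / 2 - y - sin_series H y)
  - N^-1 * ((cos (N * y) - c * cos y) * (sin y)^-1).
have pi0 := pi_gt0 R.
(* [N] is odd, so [cos (N * (pi / 2))] vanishes, and the terms of [sin_series] at [pi / 2] are sines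
   of multiples of [pi]. *)
have g_pihalf c : g c (pi / 2) = 0.
  rewrite /g cos_pihalf mulr0 !subr0.
  have -> : N * (pi / 2) = pi *+ H + pi / 2 by rewrite -[pi *+ H]mulr_natr /N; field.
  rewrite cosDpihalf sin_pi_natr oppr0 mul0r mulr0 subr0 subrr sub0r.
  rewrite /sin_series big1 ?oppr0// => h _.
  by rewrite (_ : _ * (pi / 2) = pi *+ h.+1) ?sin_pi_natr ?mul0r// -mulr_natr; field.
have coscos (z : R) : `|cos (N * z) * cos z| <= 1.
  by rewrite normrM -[leRHS]mulr1 ler_pM// cos_max.
have dg_ge0 (z : R) : 0 < z < pi -> 0 <= (cos (N * z) * cos z - -1) / (N * sin z ^+ 2).
  move=> /sin_gt0_pi s0; apply: divr_ge0; last by rewrite mulr_ge0 ?sqr_ge0// ltW.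
  by have := coscos z; rewrite ler_norml => /andP[? _]; lra.
have dg_le0 (z : R) : 0 < z < pi -> 0 <= - ((cos (N * z) * cos z - 1) / (N * sin z ^+ 2)).
  move=> /sin_gt0_pi s0; rewrite -mulNr; apply: divr_ge0.
    by have := coscos z; rewrite ler_norml => /andP[_ ?]; lra.
  by rewrite mulr_ge0 ?sqr_ge0// ltW.
have g_homo : forall x z : R, 0 < x -> x <= z -> z < pi -> g (-1) x <= g (-1) z.
  exact: ndecr_itv0pi (@is_derive_sawtooth_error R H (-1)) dg_ge0.
have g_nhomo : forall x z : R, 0 < x -> x <= z -> z < pi -> - g 1 x <= - g 1 z.
  exact: ndecr_itv0pi
    (fun z zp => is_deriveN (@is_derive_sawtooth_error R H 1 z zp)) dg_le0.
have s0 : 0 < sin y by rewrite sin_gt0_pi ?y0.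
suff : g (-1) y <= 0 <= g 1 y \/ g 1 y <= 0 <= g (-1) y.
  rewrite /g; set e := _ - sin_series H y.
  have -> : 2 / (N * sin y) = N^-1 * (2 * (sin y)^-1) by field; rewrite !gt_eqF.
  have i0 : 0 < (sin y)^-1 by rewrite invr_gt0.
  have j0 : 0 < N^-1 by rewrite invr_gt0.
  have := cos_max y; have := cos_max (N * y); rewrite !ler_norml.
  move: (cos y) (cos (N * y)) ((sin y)^-1) (N^-1) i0 j0 => a b i j i0 j0.
  move=> /andP[? ?] /andP[? ?].
  have ji : 0 < j * i by rewrite mulr_gt0.
  move=> [] /andP[H1 H2]; apply/andP; split; nra.
have [yh|yh] := leP y (pi / 2); [left|right].
  have h2 : pi / 2 < (pi : R) by lra.
  have := g_homo _ _ y0 yh h2; have := g_nhomo _ _ y0 yh h2.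
  by rewrite !g_pihalf lerN2 => -> ->.
have h2 : 0 < (pi : R) / 2 by lra.
have := g_homo _ _ h2 (ltW yh) yp; have := g_nhomo _ _ h2 (ltW yh) yp.
by rewrite !g_pihalf lerN2 => -> ->.
Qed.

Lemma norm_sinD_pi_natr (R : realType) (x : R) k : `|sin (x + pi *+ k)| = `|sin x|.
Proof. by elim: k => [|k IH]; rewrite ?addr0// mulrSr addrA sinDpi normrN. Qed.

Lemma norm_cosD_pi_natr (R : realType) (x : R) k : `|cos (x + pi *+ k)| = `|cos x|.
Proof. by elim: k => [|k IH]; rewrite ?addr0// mulrSr addrA cosDpi normrN. Qed.

Lemma sin_seriesDpi (R : realType) H (y : R) k :
  sin_series H (y + pi *+ k) = sin_series H y.
Proof.
apply: eq_bigr => h _; congr (_ / _).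
rewrite (_ : _ * (y + _) = 2 * h.+1%:R * y + pi *+ 2 *+ (h.+1 * k)).
  by rewrite (periodicn (@sinD2pi R)).
rewrite mulrDr; congr (_ + _).
by rewrite -(mulr_natr pi k) -(mulr_natr (pi *+ 2)) -(mulr_natr pi 2) natrM; ring.
Qed.

(* Fourier polynomial of the square wave worth 1 on [m, m + 1/2[ and -1 on
   [m - 1/2, m[, obtained as the difference of two sawtooth waves. *)
Definition square_poly (R : realType) H (r : R) : R :=
  2 / pi * (sin_series H (pi * r) - sin_series H (pi * r + pi / 2)).

Lemma two_div_pi (R : realType) : (0 <= 2 / pi :> R) && (2 / pi <= 1 :> R).
Proof.
by rewrite divr_ge0 ?pi_ge0//= ler_pdivrMr ?pi_gt0// mul1r pi_ge2.
Qed.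

(** Put [u = r - m]. The two sawtooth errors, at [pi u] and [pi u + pi / 2], are governed by the
    inverses of [|sin (pi u)|] and [|cos (pi u)|]. Since [|sin (2 pi u)|] is twice the product of
    these two numbers, each of them is at least [d / 2], and the two errors are at most
    [4 / ((2 H + 1) d)] each. *)
Lemma square_approx (R : realType) H (r : R) (m : nat) (d : R) :
  0 < d -> - 2^-1 <= r - m%:R < 2^-1 -> d <= `|sin (pi * (2 * r))| ->
  `|(if m%:R <= r then 1 else -1) - square_poly H r| <= 8 / ((2 * H%:R + 1) * d).
Proof.
move=> d0; set u := r - m%:R; have -> : r = u + m%:R by rewrite /u subrK.
rewrite /square_poly (_ : pi * (2 * _) = (pi * (u + m%:R)) *+ 2); last first.
  by rewrite mulr2n; ring.
rewrite [pi * (u + _)]mulrDr mulr_natr => /andP[u1 u2].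
rewrite sin_mulr2n normrMn normrM norm_sinD_pi_natr norm_cosD_pi_natr => dsc.
rewrite (addrAC (pi * u)) !sin_seriesDpi lerDr.
have pi0 := pi_gt0 R; have pi2 := pi_ge2 R.
have c1 := cos_max (pi * u); have s1 := sin_max (pi * u).
have [ds dc] : d / 2 <= `|sin (pi * u)| /\ d / 2 <= `|cos (pi * u)|.
  have s2 := normr_ge0 (sin (pi * u)); have c2 := normr_ge0 (cos (pi * u)).
  by rewrite mulr2n in dsc; split; nra.
have N0 : 0 < 2 * H%:R + 1 :> R by rewrite ltr_wpDl// mulr_ge0.
have bound (y : R) : 0 < y < pi -> d / 2 <= `|sin y| ->
    `|pi / 2 - y - sin_series H y| <= 4 / ((2 * H%:R + 1) * d).
  move=> yp dy; apply: le_trans (sawtooth_approx H yp) _.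
  have s0 := sin_gt0_pi yp; rewrite gtr0_norm// in dy.
  rewrite ler_pdivrMr ?mulr_gt0//.
  rewrite (_ : _ * (_ * sin y) = 4 * sin y / d); last by field; rewrite !gt_eqF.
  by rewrite ler_pdivlMr//; lra.
have u0 : u != 0.
  by apply: contraTneq ds => ->; rewrite mulr0 sin0 normr0 -ltNge divr_gt0.
have u12 : - 2^-1 < u.
  rewrite lt_neqAle u1 andbT; apply: contraTneq dc => <-.
  by rewrite mulrN cosN cos_pihalf normr0 -ltNge divr_gt0.
have tail (x y z : R) : `|x| <= 4 / ((2 * H%:R + 1) * d) ->
    `|y| <= 4 / ((2 * H%:R + 1) * d) -> z = 2 / pi * (x - y) ->
    `|z| <= 8 / ((2 * H%:R + 1) * d).
  move=> xb yb ->; rewrite normrM ger0_norm; last by rewrite divr_ge0 ?ltW.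
  have -> : 8 / ((2 * H%:R + 1) * d) = 4 / ((2 * H%:R + 1) * d) +
     4 / ((2 * H%:R + 1) * d) by field; rewrite !gt_eqF.
  have /andP[? ?] := two_div_pi R; apply: le_trans (lerD xb yb).
  apply: le_trans (ler_normB x y); have := normr_ge0 (x - y); nra.
have up2 : 0 < pi * u + pi / 2 < pi.
  by apply/andP; split; nra.
have b2 := bound _ up2; rewrite sinDpihalf in b2; have {}b2 := b2 dc.
have [u0'|u0'] := leP 0 u.
  have up : 0 < pi * u < pi.
    rewrite mulr_gt0//=; last by rewrite lt_neqAle eq_sym u0.
    by nra.
  apply: tail (bound _ up ds) b2 _; move: pi0; clear.
  move: (sin_series _ _) => s; move: (sin_series _ _) => t; move: (@pi R) => p p0; field.
  by rewrite gt_eqF.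
(* For negative [u] a shift by the period [pi] brings the argument back into []0, pi[]. *)
have up : 0 < pi * u + pi < pi by apply/andP; split; nra.
have b1 := bound _ up; rewrite sinDpi normrN in b1; have {}b1 := b1 ds.
have Epi := sin_seriesDpi H (pi * u) 1; rewrite mulr1n in Epi; rewrite Epi in b1.
apply: tail b1 b2 _; move: pi0; clear.
move: (sin_series _ _) => s; move: (sin_series _ _) => t; move: (@pi R) => p p0; field.
by rewrite gt_eqF.
Qed.

(* A majorant of [min (2 ^+ J) (s^-1)] for [0 <= s <= 1], built from indicators so
   that its integral reduces to measures of slabs. *)
Definition layers (R : realType) J (s : R) : R :=
  1 + \sum_(j < J) 2 ^+ j * (s < (2 ^+ j)^-1)%R%:R.

(** In the step from [J] to [J + 1]: if [s >= 2^-J], then [B <= 1 / s <= 2^J] and the layers below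
    [J] suffice; otherwise all indicators are 1 and the geometric sum is exactly [2^(J+1)]. *)
Lemma le_layers (R : realType) J (B s : R) :
  0 <= s -> B <= 2 ^+ J -> B * s <= 1 -> B <= layers J s.
Proof.
move=> s0; elim: J => [|J IH] BJ Bs; first by rewrite /layers big_ord0 addr0.
have [sJ|sJ] := ltP s (2 ^+ J)^-1; last first.
  apply: (@le_trans _ _ (layers J s)).
    apply: IH => //; rewrite -(ler_pM2r (x := s)); last first.
      by apply: lt_le_trans sJ; rewrite invr_gt0 exprn_gt0.
    apply: le_trans Bs _; rewrite mulrC -ler_pdivrMr ?exprn_gt0//.
    by rewrite div1r.
  by rewrite lerD2l big_ord_recr/= lerDl mulr_ge0.
apply: le_trans BJ _; rewrite le_eqVlt; apply/orP; left; apply/eqP.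
rewrite /layers (eq_bigr (fun j : 'I_J.+1 => 2 ^+ j)) => [|j _].
  elim: {sJ IH Bs} J.+1 => [|k IH]; first by rewrite big_ord0 expr0 addr0.
  by rewrite big_ord_recr/= addrA -IH exprS; ring.
rewrite (lt_le_trans sJ) ?mulr1// lef_pV2 ?posrE ?exprn_gt0//.
by rewrite ler_eXn2l ?ltr1n// -ltnS.
Qed.

(** A crude bound of logarithmic size in [H], for the points too close to a jump for
    [square_approx]. *)
Lemma norm_square_poly (R : realType) H (r : R) :
  `|square_poly H r| <= 2 * \sum_(h < H) h.+1%:R^-1.
Proof.
have S y : `|sin_series H y| <= \sum_(h < H) h.+1%:R^-1 :> R.
  apply: le_trans (ler_norm_sum _ _ _) _; apply: ler_sum => h _.
  by rewrite normrM [`|_^-1|]ger0_norm// ler_piMl// sin_max.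
have /andP[p0 p1] := two_div_pi R.
rewrite normrM ger0_norm//; apply: le_trans (ler_piMl _ p1) _ => //.
by apply: le_trans (ler_normB _ _) _; rewrite [leRHS]mulr_natl [leRHS]mulr2n lerD.
Qed.

(** After exchanging the sums, each frequency leaves a sum of sines in arithmetic progression,
    bounded both by its number of terms and by [sin_sum_bound]; [le_layers] merges the two bounds.
    The factor 2 counts the two sawtooth waves. *)
Lemma norm_sum_square_poly (R : realType) H J p q (x y : R) :
  (p <= q)%N -> (q - p)%:R <= 2 ^+ J :> R ->
  `|\sum_(p <= k < q) square_poly H (x + k%:R * y)| <=
  \sum_(h < H) 2 / h.+1%:R * layers J `|sin (pi * (h.+1%:R * y))|.
Proof.
move=> pq qpJ; have /andP[p0 p1] := two_div_pi R.
have trig h c : `|\sum_(p <= k < q) sin (2 * h.+1%:R * (pi * (x + k%:R * y) + c))|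
    <= layers J `|sin (pi * (h.+1%:R * y))|.
  apply: le_layers => //.
    apply: le_trans qpJ; apply: le_trans (ler_norm_sum _ _ _) _.
    rewrite -sumr_const_nat.
    by apply: ler_sum => k _; exact: sin_max.
  have E (k : nat) : 2 * h.+1%:R * (pi * (x + k%:R * y) + c) =
      2 * h.+1%:R * (pi * x + c) + k%:R * (2 * (pi * (h.+1%:R * y))) by ring.
  under eq_bigr => k _ do rewrite E.
  have := sin_sum_bound (2 * h.+1%:R * (pi * x + c)) (2 * (pi * (h.+1%:R * y))) pq.
  by rewrite (mulrC 2 (pi * _)) mulfK.
rewrite -mulr_sumr normrM ger0_norm//; apply: le_trans (ler_piMl _ p1) _ => //.
rewrite (eq_bigr (fun k : nat => \sum_(h < H) h.+1%:R^-1 *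
  (sin (2 * h.+1%:R * (pi * (x + k%:R * y) + 0)) -
   sin (2 * h.+1%:R * (pi * (x + k%:R * y) + pi / 2))))); last first.
  move=> k _; rewrite -sumrB; apply: eq_bigr => h _.
  by rewrite addr0 mulrBr [_^-1 * _]mulrC [_^-1 * _]mulrC.
rewrite exchange_big/=; apply: le_trans (ler_norm_sum _ _ _) _.
apply: ler_sum => h _; rewrite -mulr_sumr normrM ger0_norm//.
rewrite [2 / _]mulrC -mulrA ler_wpM2l// sumrB.
by apply: le_trans (ler_normB _ _) _; rewrite [leRHS]mulr_natl [leRHS]mulr2n lerD.
Qed.

Lemma harmonic_le (R : realType) L :
  \sum_(h < 2 ^ L) h.+1%:R^-1 <= 1 + L%:R :> R.
Proof.
elim: L => [|L IH]; first by rewrite expn0 big_ord1 invr1 addr0.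
rewrite expnS mul2n -addnn big_split_ord/= -natr1 addrA lerD//.
apply: (@le_trans _ _ (\sum_(h < 2 ^ L) (2 ^ L)%:R^-1)).
  apply: ler_sum => h _; rewrite lef_pV2 ?posrE ?ltr0n ?expn_gt0//.
  by rewrite ler_nat (leq_trans (leq_addr h _)).
by rewrite sumr_const card_ord -[_ *+ _]mulr_natr mulVf// pnatr_eq0 -lt0n expn_gt0.
Qed.

(** * Counting functions of the cells *)

(** Makes the rows met at a given point a block of consecutive indices, as the bound on sums of
    sines requires. *)
Lemma convex_pred_interval (P : pred nat) n :
  (forall i j k, (i <= j <= k)%N -> P i -> P k -> P j) ->
  exists p q, [/\ (p <= q)%N, (q <= n)%N &
    forall k, (k < n)%N -> P k = (p <= k < q)%N].
Proof.
move=> cP; elim: n => [|n [p [q [pq qn PE]]]]; first by exists 0%N, 0%N.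
have [Pn|Pn] := boolP (P n); last first.
  exists p, q; split; rewrite ?(leqW qn)// => k; rewrite ltnS leq_eqVlt.
  by case/predU1P => [->|/PE//]; rewrite (negbTE Pn) ltnNge qn andbF.
have [pq'|qp] := ltnP p q; last first.
  exists n, n.+1; split=> // k; rewrite ltnS => kn; rewrite kn andbT.
  move: kn; rewrite leq_eqVlt => /predU1P[->|kn]; first by rewrite Pn leqnn.
  by rewrite PE// [RHS]leqNgt kn; apply/negbTE; lia.
exists p, n.+1; split=> //; first lia.
move=> k; rewrite ltnS => kn; rewrite kn andbT.
move: (kn); rewrite leq_eqVlt => /predU1P[->|kn']; first by rewrite Pn; lia.
rewrite PE//; have [pk/=|//] := leqP p k.
(* Otherwise [q <= k < n]; since [P] holds at [q - 1] and at [n], convexity gives [P k], against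
   [PE]. *)
apply/negPn/negP => kq; have := PE _ kn'; rewrite pk (negbTE kq) => /negP; apply.
apply: (cP q.-1 k n); rewrite ?Pn//; first lia.
by rewrite PE; lia.
Qed.

Lemma big_convex_pred (V : nmodType) (P : pred nat) n (F : nat -> V) :
  (forall i j k, (i <= j <= k)%N -> P i -> P k -> P j) ->
  exists p q, [/\ (p <= q)%N, (q <= n)%N &
    \sum_(k < n | P k) F k = \sum_(p <= k < q) F k].
Proof.
move=> /(convex_pred_interval n)[p [q [pq qn PE]]]; exists p, q; split=> //.
rewrite -(big_mkord P) [RHS](big_nat_widenl p 0%N)// [RHS](big_nat_widen 0 q n)//.
by apply: congr_big_nat => // k /andP[_ kn]; rewrite PE// andbT.
Qed.

(* Twice the number of grid points in [0, r] minus the number of their shifts by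
   1/2 and -1/2 that are at most [r]. *)
Definition cell_count (R : realType) n (r : R) : R :=
  \sum_(j < n) (2 * (j%:R <= r)%R%:R - (j%:R + 2^-1 <= r)%R%:R
    - (j%:R - 2^-1 <= r)%R%:R).

(** The [j]-th summand is -1 on [[j - 1/2, j[], 1 on [[j, j + 1/2[] and 0 elsewhere; these cells
    tile [[-1/2, n - 1/2[]. *)
Lemma cell_countE (R : realType) n (r : R) :
  if - 2^-1 <= r < n%:R - 2^-1 then
    exists2 m : nat, - 2^-1 <= r - m%:R < 2^-1 &
      cell_count n r = if m%:R <= r then 1 else -1
  else cell_count n r = 0.
Proof.
elim: n => [|n]; rewrite /cell_count; first by rewrite big_ord0; case: ifP => //; lra.
rewrite big_ord_recr/=; move: (\sum_(j < n) _) => c.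
rewrite -[n.+1%:R]natr1; have n0 : 0 <= n%:R :> R by [].
have cell0 b : (n%:R <= r)%R = b -> (n%:R + 2^-1 <= r)%R = b ->
    (n%:R - 2^-1 <= r)%R = b ->
    2 * (n%:R <= r)%R%:R - (n%:R + 2^-1 <= r)%R%:R - (n%:R - 2^-1 <= r)%R%:R = 0 :> R.
  by move=> -> -> ->; case: b => /=; lra.
case: ifPn => [/andP[r1 r2] [m mr ->]|rn ->].
  rewrite ifT; last by lra.
  by exists m => //; rewrite (cell0 false) ?addr0//; lra.
case: ifPn => [/andP[r1 r2]|].
  exists n; first by lra.
  rewrite add0r (_ : (n%:R + 2^-1 <= r)%R = false); last by lra.
  rewrite (_ : (n%:R - 2^-1 <= r)%R = true); last by lra.
  by case: (n%:R <= r)%R => /=; lra.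
move=> rn'; have [r1|r1] := ltP r (- 2^-1).
  by rewrite (cell0 false) ?addr0//; lra.
by rewrite (cell0 true) ?addr0//; lra.
Qed.

Lemma affine_convex (R : realType) (x y p q : R) (i j k : nat) :
  (i <= j <= k)%N -> p <= x - i%:R * y < q -> p <= x - k%:R * y < q ->
  p <= x - j%:R * y < q.
Proof.
move=> /andP[ij jk] /andP[? ?] /andP[? ?].
have ij' : i%:R <= j%:R :> R by rewrite ler_nat.
have jk' : j%:R <= k%:R :> R by rewrite ler_nat.
by have [y0|y0] := leP 0 y; apply/andP; split; nra.
Qed.

(** [W k] says that the [k]-th argument lies in the range where the count can be nonzero. There the
    count is split into [square_poly], summed over consecutive [k], and an error: small away from
    the jumps, bounded crudely near them. The existence indicator makes the bound vanish for large
    [|x|], so that it can be integrated. *)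
Lemma norm_sum_cell_count (R : realType) H J n (x y d : R)
    (W := fun k : nat => - 2^-1 <= x - k%:R * y < n%:R - 2^-1) :
  0 < d -> n%:R <= 2 ^+ J :> R ->
  `|\sum_(k < n) cell_count n (x - k%:R * y)| <=
    [exists k : 'I_n, W k]%:R *
      (\sum_(h < H) 2 / h.+1%:R * layers J `|sin (pi * (h.+1%:R * y))| +
       n%:R * (8 / ((2 * H%:R + 1) * d))) +
    \sum_(k < n) (1 + 2 * \sum_(h < H) h.+1%:R^-1) *
      (W k && (`|sin (pi * (2 * (x - k%:R * y)))| < d))%:R.
Proof.
move=> d0 nJ.
have e0 : 0 <= 8 / ((2 * H%:R + 1) * d).
  by rewrite divr_ge0// mulr_ge0 ?ltW// addr_ge0// mulr_ge0.
have E0 : 0 <= 1 + 2 * \sum_(h < H) h.+1%:R^-1 :> R.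
  by rewrite addr_ge0// mulr_ge0// sumr_ge0.
have -> : \sum_(k < n) cell_count n (x - k%:R * y) =
    \sum_(k < n | W k) cell_count n (x - k%:R * y).
  rewrite [RHS]big_mkcond/=; apply: eq_bigr => k _.
  by have := cell_countE n (x - k%:R * y); rewrite -/(W k); case: (W k).
have [W0|/existsPn W0] := boolP [exists k : 'I_n, W k]; last first.
  rewrite mul0r add0r big_pred0 ?normr0; last by move=> k; exact/negbTE.
  by apply: sumr_ge0 => k _; rewrite mulr_ge0.
rewrite mul1r.
rewrite (eq_bigr (fun k : 'I_n => square_poly H (x - k%:R * y) +
  (cell_count n (x - k%:R * y) - square_poly H (x - k%:R * y)))); last first.
  by move=> k _; rewrite [RHS]addrC subrK.
rewrite big_split/= -addrA; apply: le_trans (ler_normD _ _) _; apply: lerD.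
  have cW i j k : (i <= j <= k)%N -> W i -> W k -> W j by exact: affine_convex.
  have [p [q [pq qn ->]]] :=
    big_convex_pred n (fun k => square_poly H (x - k%:R * y)) cW.
  rewrite (eq_bigr (fun k : nat => square_poly H (x + k%:R * - y))); last first.
    by move=> k _; rewrite mulrN.
  have := @norm_sum_square_poly R H J p q x (- y) pq.
  move=> /(_ _)/le_trans; apply.
    by apply: le_trans nJ; rewrite ler_nat; lia.
  by apply: ler_sum => h _; rewrite !mulrN sinN normrN.
apply: le_trans (ler_norm_sum _ _ _) _.
rewrite -[n in n%:R * _]card_ord -sum1_card natr_sum mulr_suml -big_split/=.
rewrite big_mkcond/=; apply: ler_sum => k _; rewrite mul1r.
case: ifPn => Wk; last by rewrite mulr0 addr0.
have := cell_countE n (x - k%:R * y); rewrite -/(W k) Wk => -[m mr ->].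
have [sd|sd] := ltP `|sin (pi * (2 * (x - k%:R * y)))| d; last first.
  by rewrite mulr0 addr0; exact: square_approx.
rewrite mulr1; apply: le_trans (ler_normB _ _) _.
rewrite ler_wpDl// lerD ?norm_square_poly//.
by case: ifP; rewrite ?normrN normr1.
Qed.

(** * Measures of slabs on the line *)

Lemma norm_sinD_pi_int (R : realType) (x : R) (m : int) :
  `|sin (x + pi * m%:~R)| = `|sin x|.
Proof.
case: m => k; first by rewrite -pmulrn mulr_natr norm_sinD_pi_natr.
rewrite NegzE mulrNz mulrN -pmulrn mulr_natr.
by rewrite -(norm_sinD_pi_natr (x - pi *+ k.+1) k.+1) subrK.
Qed.

(** Write [sin x = 2 sin (x / 2) cos (x / 2)] and apply the mean value theorem to [sin (x / 2)];
    both cosines that appear are at least 1/2 on [[0, pi / 4]]. *)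
Lemma sin_ge_quarter (R : realType) (x : R) : 0 <= x <= pi / 2 -> x / 4 <= sin x.
Proof.
move=> /andP[x0 xp]; have p0 := pi_gt0 R.
have [->|xn0] := eqVneq x 0; first by rewrite mul0r sin0.
have {xn0}x0 : 0 < x by rewrite lt_neqAle eq_sym xn0.
have cos_half (y : R) : 0 <= y <= pi / 4 -> 2^-1 <= cos y.
  move=> /andP[y0 yp]; have c0 : 0 <= cos y.
    by apply: cos_ge0_pihalf; apply/andP; split; lra.
  have : 0 <= cos (y *+ 2).
    by apply: cos_ge0_pihalf; apply/andP; split; lra.
  by rewrite cos_mulr2n; have := cos_le1 y; rewrite expr2; nra.
have x20 : 0 < x / 2 by lra.
have [c /[!in_itv]/= cx] : exists2 c, c \in `]0, x / 2[%R &
    sin (x / 2) - sin 0 = cos c * (x / 2 - 0).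
  apply: (@MVT R sin cos) => //.
  by apply: continuous_subspaceT; exact: continuous_sin.
rewrite sin0 !subr0 => sx.
have c1 : 2^-1 <= cos c by apply: cos_half; lra.
have c2 : 2^-1 <= cos (x / 2) by apply: cos_half; lra.
have -> : x = (x / 2) *+ 2 by lra.
have c12 : 4^-1 <= cos c * cos (x / 2) by nra.
rewrite sin_mulr2n sx; nra.
Qed.

(** For [m] the nearest integer and [u = s - m], [d > |sin (pi u)| >= pi |u| / 4 >= |u| / 2]. *)
Lemma near_int (R : realType) (s d : R) : `|sin (pi * s)| < d ->
  exists2 m : int, `|s - m%:~R| <= 2^-1 & `|s - m%:~R| <= 2 * d.
Proof.
move=> sd; pose m := Num.floor (s + 2^-1); exists m.
  have := floor_itv (s + 2^-1); rewrite -/m intrD => /andP[? ?].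
  by rewrite ler_norml; apply/andP; split; lra.
set u := s - m%:~R.
have u12 : `|u| <= 2^-1.
  have := floor_itv (s + 2^-1); rewrite -/m intrD => /andP[? ?].
  by rewrite /u ler_norml; apply/andP; split; lra.
have p0 := pi_gt0 R; have p2 := pi_ge2 R; have n0 := normr_ge0 u.
have us : `|sin (pi * `|u|)| = `|sin (pi * s)|.
  rewrite (_ : s = u + m%:~R); last by rewrite subrK.
  rewrite mulrDr norm_sinD_pi_int.
  by case: (ger0P u) => _; rewrite ?mulrN ?sinN ?normrN.
have pu : 0 <= pi * `|u| <= pi / 2 by apply/andP; split; nra.
have := sin_ge_quarter pu; have := ler_norm (sin (pi * `|u|)); rewrite us.
nra.
Qed.

Definition slab (R : realType) (l c p q d : R) : set R :=
  [set t | p <= l * t + c <= q /\ `|sin (pi * (l * t + c))| < d].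

Lemma measurable_affine (R : realType) (l c : R) :
  measurable_fun setT (fun t : R => l * t + c).
Proof. by apply: measurable_funD => //; exact: measurable_funM. Qed.

Lemma measurable_slab (R : realType) (l c p q d : R) : measurable (slab l c p q d).
Proof.
have mf := measurable_affine l c.
have ms : measurable_fun setT (fun t : R => `|sin (pi * (l * t + c))|).
  apply: measurableT_comp => //; apply: measurableT_comp.
    by apply: continuous_measurable_fun; exact: continuous_sin.
  exact: measurable_funM.
rewrite (_ : slab _ _ _ _ _ = (fun t => l * t + c) @^-1` `[p, q] `&`
   (fun t : R => `|sin (pi * (l * t + c))|) @^-1` `]-oo, d[).
  by apply: measurableI; rewrite -[X in measurable X]setTI; [exact: mf|exact: ms].
by apply/seteqP; split => t /=; rewrite !in_itv/=.
Qed.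

(** The slab is covered by intervals of length [4 d / |l|] centred where [l t + c] is an integer
    between [floor p] and [floor q + 1]; there are at most [q - p + 3] such integers. *)
Lemma lebesgue_slab_le (R : realType) (l c p q d : R) :
  l != 0 -> 0 < d -> p <= q ->
  (lebesgue_measure (slab l c p q d) <= ((q - p + 3) * (4 * d / `|l|))%:E)%E.
Proof.
move=> l0 d0 pq.
have absz_lt (f g k : int) : g <= f -> g <= k -> k < f + 2 ->
    (`|k - g| < `|f - g|.+2)%N by clear; lia.
have nl0 : 0 < `|l| by rewrite normr_gt0.
pose m0 := Num.floor p; pose N := `|Num.floor q - m0|.+2%N.
pose x (k : nat) := ((m0 + k%:Z)%:~R - c) / l.
pose e := 2 * d / `|l|.
have e0 : 0 < e by rewrite divr_gt0// mulr_gt0.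
pose F (k : nat) : set R := `[x k - e, x k + e]%classic.
have fqp : m0 <= Num.floor q by exact: le_floor.
have sub : slab l c p q d `<=` \big[setU/set0]_(k < N) F k.
  move=> t [/andP[tp tq]] /near_int[m m1 m2]; rewrite -bigcup_mkord.
  have /andP[q1 q2] := floor_itv q; rewrite intrD in q2.
  have p1 : m0%:~R <= p . by have /andP[] := floor_itv p.
  move: m1; rewrite ler_norml => /andP[m1 m3].
  have m0m : m0 <= m.
    by rewrite -ltzD1 -(@ltr_int R) intrD; lra.
  have mq : m < Num.floor q + 2.
    by rewrite -(@ltr_int R) intrD; lra.
  exists `|m - m0|%N.
    exact: absz_lt.
  rewrite /F /= in_itv/= /x gez0_abs ?subr_ge0// (addrC m0) subrK.
  rewrite -ler_distlC -(ler_pM2l nl0) -normrM /e mulrCA mulfV ?gt_eqF// mulr1.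
  by rewrite mulrBr mulrC divfK// distrC opprB addrA.
apply: (@le_trans _ _ _ _ _ (@content_subadditive _ _ _ lebesgue_measure _ F N _
  (measurable_slab l c p q d) sub)).
  by move=> k _; exact: measurable_itv.
rewrite (eq_bigr (fun=> (4 * d / `|l|)%:E)); last first.
  move=> k _; rewrite /F /= lebesgue_measure_itv/= lte_fin ltrD2l gtrN// -EFinD.
  by congr (_%:E); rewrite /e; field; rewrite gt_eqF.
rewrite sumEFin lee_fin sumr_const card_ord -[_ *+ N]mulr_natl ler_wpM2r//.
  by rewrite divr_ge0// mulr_ge0// ltW.
have -> : N%:R = (Num.floor q - m0)%:~R + 2 :> R.
  by rewrite /N -natr1 -natr1 natr_absz ger0_norm ?subr_ge0//; ring.
have /andP[? _] := floor_itv q; have /andP[_] := floor_itv p.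
by rewrite -/m0 intrD intrB; lra.
Qed.

(** * Uniform measures on finite sequences *)

(** Repeated entries count with multiplicity. The Dirac mass at [point] is only the value for the
    empty sequence. *)
Definition atoms d (T : measurableType d) (R : realType) (s : seq T) : probability T R :=
  mnormalize (msum (fun k => \d_(nth point s k)) (size s)) \d_point.

Lemma msum_dirac_nth d (T : measurableType d) (R : realType) (s : seq T) A :
  msum (fun k => \d_(nth point s k) : {measure set T -> \bar R}) (size s) A =
  (\sum_(x <- s) (x \in A)%:R)%:E.
Proof.
rewrite /msum (big_nth point) big_mkord -sumEFin.
by apply: eq_bigr => k _; rewrite /= diracE.
Qed.

Lemma atomsE d (T : measurableType d) (R : realType) (s : seq T) A : s != [::] ->
  atoms R s A = ((\sum_(x <- s) (x \in A)%:R) / (size s)%:R)%:E.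
Proof.
move=> s0; rewrite /atoms /= /mnormalize/= !msum_dirac_nth.
have -> : \sum_(x <- s) (x \in [set: T])%:R = (size s)%:R :> R.
  rewrite (eq_bigr (fun=> 1%:R)) => [|x _]; last by rewrite in_setT.
  by rewrite -natr_sum sum1_size.
by rewrite eqe pnatr_eq0 size_eq0 (negbTE s0)/= msum_dirac_nth.
Qed.

Lemma atoms_map d (T : measurableType d) d' (U : measurableType d') (R : realType)
    (f : T -> U) (s : seq T) A : s != [::] ->
  atoms R [seq f x | x <- s] A = atoms R s (f @^-1` A).
Proof.
move=> s0; rewrite !atomsE ?size_map//; last by case: s s0.
by rewrite big_map; congr (_ / _)%:E; apply: eq_bigr => x _; rewrite preimage_in.
Qed.

Lemma atoms_eq1 d (T : measurableType d) (R : realType) (s : seq T) A :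
  s != [::] -> {in s, forall x, A x} -> atoms R s A = 1%E.
Proof.
move=> s0 sA; rewrite atomsE// big_seq (eq_bigr (fun=> 1%:R)) => [|x xs].
  by rewrite -big_seq -natr_sum sum1_size divff// pnatr_eq0 size_eq0.
by rewrite mem_set//; exact: sA.
Qed.

Lemma atoms_gt0 d (T : measurableType d) (R : realType) (s : seq T) A x :
  x \in s -> A x -> (0 < atoms R s A)%E.
Proof.
move=> xs Ax; have s0 : s != [::] by apply: contraTneq xs => ->.
rewrite atomsE// lte_fin divr_gt0 ?ltr0n ?lt0n ?size_eq0//.
rewrite (big_rem x)//= mem_set// ltr_pwDl// sumr_ge0//.
Qed.

Lemma integral_atoms d (T : measurableType d) (R : realType) (s : seq T) (f : T -> R) :
  s != [::] -> measurable_fun setT f -> (forall x, 0 <= f x) ->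
  (\int[atoms R s]_x (f x)%:E = ((\sum_(x <- s) f x) / (size s)%:R)%:E)%E.
Proof.
move=> s0 mf f0.
have k0 : 0 <= (size s)%:R^-1 :> R by [].
pose D := msum (fun k => \d_(nth point s k) : {measure set T -> \bar R}) (size s).
pose m := mscale (NngNum k0) D.
have mfE : measurable_fun setT (fun x => (f x)%:E) by exact/measurable_EFinP.
rewrite (@eq_measure_integral _ _ _ _ m); last first.
  move=> A _ _; transitivity (((size s)%:R^-1)%:E * D A)%E => //.
  by rewrite [LHS](atomsE R A s0) /D msum_dirac_nth -EFinM mulrC.
rewrite ge0_integral_mscale//; last by move=> x _; rewrite lee_fin.
rewrite ge0_integral_measure_sum//; last by move=> x _; rewrite lee_fin.
rewrite (eq_bigr (fun k : 'I_(size s) => (f (nth point s k))%:E)); last first.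
  by move=> k _; rewrite integral_dirac// diracT mul1e.
by rewrite sumEFin -EFinM/= mulrC (big_nth point) big_mkord.
Qed.

Lemma couplings_atoms d (T : measurableType d) (R : realType) (z : seq (T * T)) :
  z != [::] -> couplings (atoms R [seq p.1 | p <- z]) (atoms R [seq p.2 | p <- z]) (atoms R z).
Proof.
move=> z0 A mA; rewrite !atoms_map//; split; congr (atoms R z _).
  by apply/seteqP; split => [p []|p].
by apply/seteqP; split => [p []|p].
Qed.

Lemma wasserstein1_atoms_le d (T : measurableType d) (R : realType) (dist : T -> T -> R)
    (z : seq (T * T)) :
  z != [::] -> (forall x y, 0 <= dist x y) ->
  measurable_fun setT (fun p : T * T => dist p.1 p.2) ->
  (wasserstein1 dist (atoms R [seq p.1 | p <- z]) (atoms R [seq p.2 | p <- z]) <=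
    ((\sum_(p <- z) dist p.1 p.2) / (size z)%:R)%:E)%E.
Proof.
move=> z0 dist0 mdist; apply: ereal_inf_lbound; exists (atoms R z).
  exact: couplings_atoms.
by rewrite integral_atoms.
Qed.

Lemma perm_atoms d (T : measurableType d) (R : realType) (s s' : seq T) :
  s != [::] -> perm_eq s s' -> atoms R s = atoms R s' :> (set T -> \bar R).
Proof.
move=> s0 ss'; have s'0 : s' != [::].
  by apply: contra_neq s0 => s'0; move: ss'; rewrite s'0 => /perm_nilP.
by apply/funext => A; rewrite !atomsE// (perm_size ss') (perm_big _ ss').
Qed.

Lemma integral_dist_indicators (R : realType) (x y : R) :
  (\int[lebesgue_measure]_t (`|(x <= t)%R%:R - (y <= t)%R%:R|)%:E = `|x - y|%:E :> \bar R)%E.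
Proof.
wlog xy : x y / x <= y => [H|].
  have [/H//|/ltW/H yx] := leP x y; rewrite distrC -yx.
  by apply: eq_integral => t _; rewrite distrC.
transitivity (\int[lebesgue_measure]_t (\1_(`[x, y[) t)%:E : \bar R)%E.
  apply: eq_integral => t _; rewrite indicE mem_setE in_itv/=; congr (_%:E).
  have [yt|ty] := leP y t; rewrite ?(le_trans xy yt)/= ?subrr ?normr0 ?andbF//.
  by case: (x <= t)%R; rewrite /= subr0 ?normr1 ?normr0.
rewrite integral_indic// setIT /= lebesgue_measure_itv/= lte_fin.
have [xy'|yx] := ltP x y; first by rewrite -EFinD distrC ger0_norm ?subr_ge0.
by have -> : x = y by [apply/le_anti; rewrite xy yx]; rewrite subrr normr0.
Qed.

Lemma sum_norm_indicators (R : realType) (n p q : nat) : (p <= n)%N -> (q <= n)%N ->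
  \sum_(i < n) `|(i < p)%N%:R - (i < q)%N%:R| = `|p%:R - q%:R| :> R.
Proof.
have H k : (k <= n)%N -> \sum_(i < n) (i < k)%N%:R = k%:R :> R.
  move=> kn; rewrite -natr_sum; congr (_%:R).
  rewrite -[RHS]card_ord -sum1_card (big_ord_widen n (fun=> 1%N) kn) [RHS]big_mkcond/=.
  by apply: eq_bigr => i _; case: ltnP.
wlog qp : p q / (q <= p)%N => [W pn qn|pn qn].
  have [/W->//|/ltnW pq] := leqP q p.
  by rewrite distrC -(W q p)//; apply: eq_bigr => i _; rewrite distrC.
rewrite ger0_norm ?subr_ge0 ?ler_nat// -(H p)// -(H q)// -sumrB.
apply: eq_bigr => i _; rewrite ger0_norm// subr_ge0 ler_nat.
by case: ltnP => // iq; rewrite (leq_trans iq qp).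
Qed.

(** Monotone coupling: both sequences are sorted and matched in order. In a sorted sequence the
    [i]-th entry is at most [t] exactly when [i] is below the number of entries at most [t], so for
    fixed [t] the differences of indicators add up to the difference of the counts. *)
Lemma W1_line_atoms_le (R : realType) (s s' : seq R) :
  s != [::] -> size s' = size s ->
  (W1_line (atoms R s) (atoms R s') <= ((size s)%:R^-1)%:E *
    \int[lebesgue_measure]_t
      `|(count (<= t)%R s)%:R - (count (<= t)%R s')%:R|%:E)%E.
Proof.
move=> s0 ss'.
have s'0 : s' != [::] by rewrite -size_eq0 ss' size_eq0.
set a := sort <=%O s; set b := sort <=%O s'.
have ab : size a = size b by rewrite !size_sort.
have ap : perm_eq s a by rewrite perm_sym; exact/permPl/perm_sort.
have bp : perm_eq s' b by rewrite perm_sym; exact/permPl/perm_sort.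
rewrite (perm_atoms R s0 ap) (perm_atoms R s'0 bp).
have z0 : zip a b != [::] by rewrite -size_eq0 size_zip -ab minnn size_sort size_eq0.
have e1 : [seq p.1 | p <- zip a b] = a by apply: unzip1_zip; rewrite ab.
have e2 : [seq p.2 | p <- zip a b] = b by apply: unzip2_zip; rewrite ab.
have := @wasserstein1_atoms_le _ _ R (fun s t : R => `|s - t|) _ z0.
rewrite e1 e2 => /(_ _ _)/le_trans; apply => //.
  apply: measurableT_comp => //; exact: measurable_funB.
rewrite size_zip -ab minnn size_sort EFinM muleC; apply: lee_wpmul2l => //.
have mi (x : R) : measurable_fun [set: R] (fun t => (x <= t)%R%:R : R).
  rewrite (_ : (fun t => _) = \1_(`[x, +oo[)) //.
  by apply/funext => t; rewrite indicE mem_setE in_itv/= andbT.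
rewrite [leRHS](_ : _ = \int[lebesgue_measure]_t
  \sum_(i < size s) (`|(nth 0 a i <= t)%R%:R - (nth 0 b i <= t)%R%:R|)%:E)%E; last first.
  apply: eq_integral => t _; rewrite sumEFin (permP ap) (permP bp); congr (_%:E).
  rewrite -(@sum_norm_indicators R (size s)); last 2 first.
  - by rewrite -(size_sort <=%O s) count_size.
  - by rewrite -ss' -(size_sort <=%O s') count_size.
  have E (u : seq R) i : sorted <=%O u -> (i < size u)%N ->
      (i < count (<= t)%R u)%N = (nth 0 u i <= t)%R.
    move=> us iu; have [ic|ci] := ltnP; first by rewrite (nth_count_le _ us ic).
    by apply/esym/negbTE; rewrite -ltNge; apply: nth_count_gt; rewrite // ci.
  apply: eq_bigr => i _.
  by rewrite !E ?size_sort ?ss'//; exact: sort_le_sorted.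
rewrite ge0_integral_sum//; last first.
  move=> i; apply/measurable_EFinP; apply: measurableT_comp => //.
  by apply: measurable_funB; exact: mi.
rewrite (eq_bigr (fun i : 'I_(size s) => (`|nth 0 a i - nth 0 b i|)%:E)); last first.
  by move=> i _; rewrite integral_dist_indicators.
rewrite sumEFin lee_fin (big_nth (0, 0)) size_zip -ab minnn size_sort big_mkord.
by apply: ler_sum => i _; rewrite nth_zip.
Qed.

(* Unlike [ge0_le_integral], no measurability is required. *)
Lemma ge0_le_integral_nonmeasurable d (T : measurableType d) (R : realType)
    (mu : {measure set T -> \bar R}) (D : set T) (f1 f2 : T -> \bar R) :
  (forall x, D x -> (0 <= f1 x)%E) -> (forall x, D x -> (f1 x <= f2 x)%E) ->
  (\int[mu]_(x in D) f1 x <= \int[mu]_(x in D) f2 x)%E.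
Proof.
move=> f10 f12; have f20 x : D x -> (0 <= f2 x)%E.
  by move=> Dx; exact: le_trans (f10 x Dx) (f12 x Dx).
rewrite !ge0_integralE//; apply: ge_ereal_sup => _ [h/= hf] <-.
apply: ereal_sup_ubound; exists h => //= x; apply: le_trans (hf x) _.
exact: lee_restrict.
Qed.

(** * Integrals of the counting functions *)

Lemma layers_ge0 (R : realType) J (s : R) : 0 <= layers J s.
Proof.
by apply: addr_ge0 => //; apply: sumr_ge0 => j _; apply: mulr_ge0.
Qed.

Lemma integral_sum_indic d (T : measurableType d) (R : realType)
    (mu : {measure set T -> \bar R}) (I : Type) (r : seq I) (c : I -> R) (A : I -> set T) :
  (forall i, measurable (A i)) -> (forall i, 0 <= c i) ->
  (\int[mu]_x (\sum_(i <- r) c i * \1_(A i) x)%:E = \sum_(i <- r) (c i)%:E * mu (A i))%E.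
Proof.
move=> mA c0; under eq_integral do rewrite -sumEFin.
have mi i : measurable_fun setT (fun x => (c i * \1_(A i) x)%:E).
  by apply/measurable_EFinP; apply: measurable_funM.
rewrite ge0_integral_sum//; last by move=> i x _; rewrite lee_fin mulr_ge0.
apply: eq_bigr => i _; under eq_integral do rewrite EFinM.
rewrite ge0_integralZl_EFin//.
- by rewrite integral_indic// setIT.
- by apply/measurable_EFinP.
Qed.

(** Integrates [norm_sum_cell_count] with [x = t / a + c] and [y = b / a]. The bounds on [a], [b],
    [c] confine the relevant [t] to [[-3n, 3n]], of length [6n], and each row adds a slab of measure
    at most [2 d (2n + 3)] near the jumps. *)
Lemma integral_cell_count_le (R : realType) H J n (a b c d : R) :
  0 < a <= 1 -> `|b| <= 1 -> 0 <= c <= n%:R -> 0 < d -> n%:R <= 2 ^+ J :> R ->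
  (\int[lebesgue_measure]_t
     (`|\sum_(k < n) cell_count n (a^-1 * t + c - k%:R * (b / a))|)%:E <=
   ((\sum_(h < H) 2 / h.+1%:R * layers J `|sin (pi * (h.+1%:R * (b / a)))| +
       n%:R * (8 / ((2 * H%:R + 1) * d))) * (6 * n%:R) +
    n%:R * ((1 + 2 * \sum_(h < H) h.+1%:R^-1) * (2 * d * (2 * n%:R + 3))))%:E)%E.
Proof.
move=> /andP[a0 a1] b1 /andP[c0 cn] d0 nJ; set B := \sum_(h < H) _ + _.
set E := 1 + _; pose W t (k : nat) := - 2^-1 <= a^-1 * t + c - k%:R * (b / a) < n%:R - 2^-1.
have E0 : 0 <= E by rewrite addr_ge0// mulr_ge0// sumr_ge0.
have B0 : 0 <= B.
  rewrite addr_ge0//; last by rewrite mulr_ge0// divr_ge0// mulr_ge0 ?ltW// addr_ge0// mulr_ge0.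
  by apply: sumr_ge0 => h _; rewrite mulr_ge0// layers_ge0.
(* [None] indexes the interval carrying the main bound [B], and [Some k] the neighbourhood of the
   jumps of row [k]. The argument is doubled because the wave jumps at integers and at
   half-integers. *)
pose A (i : option 'I_n) : set R := if i is Some k
  then slab (2 / a) (2 * (c - k%:R * (b / a))) (- 1) (2 * n%:R - 1) d
  else `[- (3 * n%:R), 3 * n%:R]%classic.
pose e (i : option 'I_n) := if i is Some k then E else B.
pose r := None :: [seq Some k | k <- index_enum 'I_n].
have n0 : 0 <= n%:R :> R by [].
have WA t (k : 'I_n) : W t k -> - (3 * n%:R) <= t <= 3 * n%:R.
  move=> /andP[w1 w2]; have n1 : 1 <= n%:R :> R.
    by rewrite ler1n; case: (n) k {w1 w2} => // -[].
  have kn : k%:R <= n%:R :> R by rewrite ler_nat ltnW.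
  have k0 : 0 <= k%:R :> R by [].
  rewrite -(ler_pM2l a0) in w1; rewrite -(ltr_pM2l a0) in w2.
  have E1 : a * (a^-1 * t + c - k%:R * (b / a)) = t + a * c - k%:R * b.
    by field; rewrite gt_eqF.
  rewrite E1 in w1 w2; have : `|k%:R * b| <= n%:R.
    by rewrite normrM -[leRHS]mulr1 ler_pM// ger0_norm.
  rewrite ler_norml => /andP[? ?]; apply/andP; split; nra.
apply: (@le_trans _ _ (\int[lebesgue_measure]_t (\sum_(i <- r) e i * \1_(A i) t)%:E)%E).
  apply: ge0_le_integral_nonmeasurable => t _; first by rewrite lee_fin.
  rewrite lee_fin; apply: le_trans (norm_sum_cell_count H _ _ d0 nJ) _.
  rewrite big_cons/= big_map; apply: lerD.
    rewrite mulrC ler_wpM2l// indicE ler_nat; case: existsP => // -[k Wk].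
    by rewrite mem_set//= in_itv/=; exact: WA Wk.
  apply: ler_sum => k _; rewrite ler_wpM2l// indicE ler_nat.
  case: andP => // -[/andP[w1 w2] sd]; rewrite mem_set//= /slab/=.
  rewrite (_ : 2 / a * t + _ = 2 * (a^-1 * t + c - k%:R * (b / a))); last by ring.
  by split=> //; apply/andP; split; lra.
rewrite integral_sum_indic; last 2 first.
- by case=> [k|]; [exact: measurable_slab|exact: measurable_itv].
- by case.
rewrite big_cons big_map [leRHS]EFinD.
apply: leeD.
  rewrite /= lebesgue_measure_itv/= lte_fin; case: ifP => _; last first.
    by rewrite mule0 lee_fin mulr_ge0// mulr_ge0.
  by rewrite -EFinD -EFinM lee_fin ler_wpM2l//; lra.
apply: (@le_trans _ _ (\sum_(k < n) (E * (2 * d * (2 * n%:R + 3)))%:E)%E); last first.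
  by rewrite sumEFin lee_fin sumr_const card_ord -[_ *+ n]mulr_natl.
apply: lee_sum => k _; rewrite EFinM lee_wpmul2l ?lee_fin//.
apply: le_trans (lebesgue_slab_le _ _ d0 _) _.
- by rewrite mulf_neq0// invr_neq0// gt_eqF.
- by lra.
rewrite lee_fin ger0_norm; last by rewrite divr_ge0// ltW.
rewrite (_ : 4 * d / (2 / a) = 2 * d * a); last by field; rewrite gt_eqF.
rewrite (_ : _ * (2 * d * a) = 2 * d * (2 * n%:R + 3) * a); last by ring.
by rewrite ler_piMr// !mulr_ge0 ?addr_ge0 ?mulr_ge0// (ltW d0).
Qed.

(** * The grid and its half-shifts *)

(* [x] is the coordinate along the shift axis, number 1, and [y] the one along
   axis 0. *)
Definition lattice_point (R : realType) m (x y : R) : 'rV[R]_m.+2 :=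
  \row_i (if i == 0 :> nat then y else if i == 1 :> nat then x else 0).

Lemma inner_lattice_point (R : realType) m (v : 'rV[R]_m.+2) x y :
  inner v (lattice_point m x y) = v ord0 ord0 * y + v ord0 (lift ord0 ord0) * x.
Proof.
rewrite /inner big_ord_recl big_ord_recl !mxE/= big1 ?addr0// => i _.
by rewrite !mxE/= mulr0.
Qed.

Lemma lattice_pointB (R : realType) m (x y x' y' : R) :
  lattice_point m x y - lattice_point m x' y' = lattice_point m (x - x') (y - y').
Proof.
by apply/rowP => i; rewrite !mxE; case: ifP => // _; case: ifP => // _; rewrite subr0.
Qed.

Lemma enorm_lattice_point (R : realType) m (x y : R) :
  enorm (lattice_point m x y) = Num.sqrt (x ^+ 2 + y ^+ 2).
Proof. by rewrite /enorm inner_lattice_point !mxE/= addrC. Qed.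

(** Each source point is kept with its grid point, so that one list gives both measures and a
    coupling of them. *)
Definition shifted_pairs (R : realType) m n (s : R) : seq ('rV[R]_m.+2 * 'rV[R]_m.+2) :=
  [seq (lattice_point m (j%:R + s) k%:R, lattice_point m j%:R k%:R) |
    k <- iota 0 n, j <- iota 0 n].

Definition cell_pairs (R : realType) m n : seq ('rV[R]_m.+2 * 'rV[R]_m.+2) :=
  shifted_pairs m n 2^-1 ++ shifted_pairs m n (- 2^-1).

Lemma size_cell_pairs (R : realType) m n : size (cell_pairs R m n) = (2 * n ^ 2)%N.
Proof. by rewrite size_cat !size_allpairs size_iota; lia. Qed.

Lemma sum_cell_pairs (R : realType) m n (V : nmodType)
    (F : 'rV[R]_m.+2 * 'rV[R]_m.+2 -> V) :
  \sum_(p <- cell_pairs R m n) F p = \sum_(k < n) \sum_(j < n)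
    (F (lattice_point m (j%:R + 2^-1) k%:R, lattice_point m j%:R k%:R) +
     F (lattice_point m (j%:R - 2^-1) k%:R, lattice_point m j%:R k%:R)).
Proof.
have iE (G : nat -> V) : \sum_(k <- iota 0 n) G k = \sum_(k < n) G k.
  by rewrite -(big_mkord xpredT G)/= /index_iota subn0.
rewrite big_cat !big_allpairs_dep/= !iE -big_split/=; apply: eq_bigr => k _.
by rewrite !iE -big_split.
Qed.

Lemma count_natr (R : realType) (T : Type) (P : pred T) (s : seq T) :
  (count P s)%:R = \sum_(x <- s) (P x)%:R :> R.
Proof. by rewrite -sum1_count natr_sum big_mkcond/=; apply: eq_bigr => x _; case: (P x). Qed.

Lemma pushforward_atoms d (T : measurableType d) d' (U : measurableType d')
    (R : realType) (f : T -> U) (s : seq T) : s != [::] ->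
  pushforward (atoms R s) f = atoms R [seq f x | x <- s] :> (set U -> \bar R).
Proof. by move=> s0; apply/funext => A; rewrite atoms_map. Qed.

Definition cell_source (R : realType) m n : probability 'rV[R]_m.+2 R :=
  atoms R [seq p.1 | p <- cell_pairs R m n].

Definition cell_target (R : realType) m n : probability 'rV[R]_m.+2 R :=
  atoms R [seq p.2 | p <- cell_pairs R m n].

Lemma cell_pairs_neq0 (R : realType) m n : (0 < n)%N -> cell_pairs R m n != [::].
Proof. by rewrite -size_eq0 size_cell_pairs; lia. Qed.

(** Dividing by [|a|] puts each projected row in the position of a translate of the integers. For
    [a < 0] the order is reversed: [j] becomes [n - 1 - j], whence the offset [n - 1], and the two
    half-shifts are exchanged. *)
Lemma cell_count_projection (R : realType) m n (v : 'rV[R]_m.+2) (t : R)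
    (a := v ord0 (lift ord0 ord0)) (b := v ord0 ord0) :
  a != 0 ->
  `|(count (<= t)%R [seq inner v x | x <- [seq p.1 | p <- cell_pairs R m n]])%:R -
    (count (<= t)%R [seq inner v x | x <- [seq p.2 | p <- cell_pairs R m n]])%:R| =
  `|\sum_(k < n) cell_count n
      (`|a|^-1 * t + (if 0 < a then 0 else n%:R - 1) - k%:R * (b / `|a|))|.
Proof.
move=> a0; rewrite !count_natr !big_map !sum_cell_pairs -sumrB -[RHS]normrN -sumrN.
congr `|_|; apply: eq_bigr => k _; rewrite -sumrB -sumrN /cell_count.
have na : 0 < `|a| by rewrite normr_gt0.
set r := _ - _ * _.
have term (x y : R) : y = `|a|^-1 * (b * k%:R + a * x) + (if 0 < a then 0 else n%:R - 1)
     - k%:R * (b / `|a|) ->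
    (inner v (lattice_point m x k%:R) <= t) = (y <= r).
  move=> ->; rewrite inner_lattice_point -/a -/b /r lerD2r lerD2r.
  by rewrite ler_pM2l// invr_gt0.
have [ap|an] := ltP 0 a.
  apply: eq_bigr => j _; rewrite /= !(term _ _ erefl) ap.
  have E x : `|a|^-1 * (b * k%:R + a * x) + 0 - k%:R * (b / `|a|) = x.
    by rewrite gtr0_norm//; field.
  by rewrite !E; ring.
rewrite [RHS](reindex_inj rev_ord_inj)/=; apply: eq_bigr => j _.
have {}an : a < 0 by rewrite lt_neqAle a0.
rewrite /= !(term _ _ erefl) ltNge (ltW an)/=.
have E x : `|a|^-1 * (b * k%:R + a * x) + (n%:R - 1) - k%:R * (b / `|a|) = n%:R - 1 - x.
  by rewrite ltr0_norm//; field; rewrite ltr0_neq0.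
rewrite !E natrB ?ltn_ord// -(natr1 j).
have -> : n%:R - 1 - (j%:R + 2^-1) = n%:R - (j%:R + 1) - 2^-1 :> R by ring.
have -> : n%:R - 1 - (j%:R - 2^-1) = n%:R - (j%:R + 1) + 2^-1 :> R by ring.
have -> : n%:R - 1 - j%:R = n%:R - (j%:R + 1) :> R by ring.
by ring.
Qed.

Lemma W1_line_cells_count (R : realType) m n (v : 'rV[R]_m.+2) : (0 < n)%N ->
  (W1_line (pushforward (cell_source R m n) (inner v))
     (pushforward (cell_target R m n) (inner v)) <=
   ((2 * n ^ 2)%:R^-1)%:E * \int[lebesgue_measure]_t
     `|(count (<= t)%R [seq inner v x | x <- [seq p.1 | p <- cell_pairs R m n]])%:R -
       (count (<= t)%R [seq inner v x | x <- [seq p.2 | p <- cell_pairs R m n]])%:R|%:E)%E.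
Proof.
move=> n0; have p0 := cell_pairs_neq0 R m n0.
have q0 (f : 'rV[R]_m.+2 * 'rV[R]_m.+2 -> 'rV[R]_m.+2) :
    [seq f p | p <- cell_pairs R m n] != [::] by case: (cell_pairs R m n) p0.
rewrite !pushforward_atoms ?q0//.
apply: le_trans (W1_line_atoms_le _ _) _.
- by case: (cell_pairs R m n) p0.
- by rewrite !size_map.
by rewrite !size_map size_cell_pairs.
Qed.

Lemma W1_line_cells0 (R : realType) m n (v : 'rV[R]_m.+2) : (0 < n)%N ->
  v ord0 (lift ord0 ord0) = 0 ->
  (W1_line (pushforward (cell_source R m n) (inner v))
     (pushforward (cell_target R m n) (inner v)) <= 0)%E.
Proof.
move=> n0 v0; apply: le_trans (W1_line_cells_count v n0) _.
rewrite integral0_eq ?mule0// => t _.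
rewrite !count_natr !big_map !sum_cell_pairs.
rewrite -sumrB big1 ?normr0// => k _; rewrite -sumrB big1// => j _.
by rewrite !inner_lattice_point v0 !mul0r !addr0/= subrr.
Qed.

(** The degree [2 ^ (2 * J)] is the square of the side [2 ^ J] of the grid, which keeps the
    approximation error summed over all rows bounded. *)
Definition layer_series (R : realType) J (r : R) : R :=
  \sum_(h < 2 ^ (2 * J)) 2 / h.+1%:R * layers J `|sin (pi * (h.+1%:R * r))|.

Lemma W1_line_cells_le (R : realType) m J (v : 'rV[R]_m.+2) (n := (2 ^ J)%N)
    (a := v ord0 (lift ord0 ord0)) (b := v ord0 ord0) :
  a != 0 -> `|a| <= 1 -> `|b| <= 1 ->
  (W1_line (pushforward (cell_source R m n) (inner v))
     (pushforward (cell_target R m n) (inner v)) <=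
   ((6 * layer_series J (b / a) + 54 + 40 * J%:R) / (2 * n%:R))%:E)%E.
Proof.
move=> a0 a1 b1; have n0 : (0 < n)%N by rewrite expn_gt0.
apply: le_trans (W1_line_cells_count v n0) _.
under eq_integral do rewrite cell_count_projection// -/a -/b.
have nr0 : 0 < n%:R :> R by rewrite ltr0n.
have nr1 : 1 <= n%:R :> R by rewrite ler1n.
have na : 0 < `|a| <= 1 by rewrite normr_gt0 a0.
have cn : (0 : R) <= (if 0 < a then 0 else n%:R - 1 : R) <= n%:R.
  by case: ifP => _; apply/andP; split; lra.
(* The threshold near the jumps is [d = 1 / n]: with [H = n^2] the approximation error of all rows
   is at most 4 ([e4]), and the measure of each slab is at most 10 ([e10]). *)
have d0 : 0 < n%:R^-1 :> R by rewrite invr_gt0.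
have nJ : n%:R <= 2 ^+ J :> R by rewrite /n natrX.
have := integral_cell_count_le (2 ^ (2 * J)) na b1 cn d0 nJ.
set I := integral _ _ _; set G := \sum_(h < _) _; set E := _ + 2 * _ => IE.
have G_E : G = layer_series J (b / a).
  apply: eq_bigr => h _; congr (_ * layers J _).
  have [ap|an] := ltP 0 a; first by rewrite (gtr0_norm ap).
  by rewrite (ler0_norm an) invrN !mulrN sinN normrN.
have EJ : E <= 3 + 4 * J%:R.
  have := harmonic_le R (2 * J); rewrite natrM /E; lra.
have E0 : 0 <= E by rewrite addr_ge0// mulr_ge0// sumr_ge0.
have HE : (2 ^ (2 * J))%:R = n%:R ^+ 2 :> R.
  by rewrite /n -natrX -expnM mulnC.
have e4 : n%:R * (8 / ((2 * (2 ^ (2 * J))%:R + 1) * n%:R^-1)) <= 4 :> R.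
  rewrite HE; have D0 : 0 < 2 * n%:R ^+ 2 + 1 :> R by rewrite ltr_wpDl// mulr_ge0// sqr_ge0.
  rewrite (_ : _ * _ = 8 * n%:R ^+ 2 / (2 * n%:R ^+ 2 + 1)); last first.
    by field; rewrite !gt_eqF.
  by rewrite ler_pdivrMr//; lra.
have e10 : 2 * n%:R^-1 * (2 * n%:R + 3) <= 10 :> R.
  rewrite (_ : _ * _ = (4 * n%:R + 6) / n%:R); last by field; rewrite gt_eqF.
  by rewrite ler_pdivrMr//; lra.
apply: (@le_trans _ _ (((2 * n ^ 2)%:R^-1)%:E *
   ((G + 4) * (6 * n%:R) + n%:R * ((3 + 4 * J%:R) * 10))%:E)%E).
  apply: lee_wpmul2l => //; apply: le_trans IE _; rewrite lee_fin.
  apply: lerD; first by rewrite ler_wpM2r ?mulr_ge0// lerD2l.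
  rewrite ler_wpM2l// ler_pM// mulr_ge0 ?addr_ge0 ?mulr_ge0// ltW.
rewrite -EFinM lee_fin G_E natrM natrX.
move: (layer_series _ _) => g; rewrite le_eqVlt; apply/orP; left; apply/eqP.
by field; rewrite gt_eqF.
Qed.

(** * Directions close to a resonance *)

(** The inverse is rewritten as [f / |f|^2], which involves only powers of the nonnegative [|f|]; at
    the zeros of [f] both sides are 0. *)
Lemma measurable_funVr d (T : measurableType d) (R : realType) (f : T -> R) :
  measurable_fun setT f -> measurable_fun setT (fun x => (f x)^-1).
Proof.
move=> mf; have mV : measurable_fun setT (fun x => `|f x| `^ (- 1)).
  apply: (measurableT_comp (@measurable_powR R (- 1))).
  exact: measurableT_comp.
rewrite (_ : (fun x => _) =
    (fun x => f x * (`|f x| `^ (- 1) * `|f x| `^ (- 1)))); last first.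
  apply/funext => x; rewrite powR_inv1// -invfM -expr2 real_normK ?num_real//.
  have [->|fx0] := eqVneq (f x) 0; first by rewrite mul0r invr0.
  by rewrite expr2 invfM mulrA divff// mul1r.
by apply: measurable_funM => //; exact: measurable_funM.
Qed.

Definition ratio (R : realType) m (v : 'rV[R]_m.+2) : R :=
  v ord0 ord0 / v ord0 (lift ord0 ord0).

(** Directions with vanishing shift coordinate are left out: their [ratio] is 0 by convention, so
    they would all count as resonant. [W1_line_cells0] handles them. *)
Definition near_resonance (R : realType) m (h : nat) (d : R) : set 'rV[R]_m.+2 :=
  [set v : 'rV[R]_m.+2 | v ord0 (lift ord0 ord0) != 0 /\ `|sin (pi * (h%:R * ratio v))| < d].

Lemma measurable_ratio (R : realType) m : measurable_fun setT (@ratio R m).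
Proof.
apply: measurable_funM; first exact: measurable_coord.
by apply: measurable_funVr; exact: measurable_coord.
Qed.

Lemma measurable_near_resonance (R : realType) m h (d : R) :
  measurable (@near_resonance R m h d).
Proof.
have ms : measurable_fun setT (fun v : 'rV[R]_m.+2 => `|sin (pi * (h%:R * ratio v))|).
  apply: measurableT_comp => //; apply: measurableT_comp.
    by apply: continuous_measurable_fun; exact: continuous_sin.
  by apply: measurable_funM => //; apply: measurable_funM => //; exact: measurable_ratio.
rewrite (_ : near_resonance _ _ = (fun v : 'rV[R]_m.+2 => v ord0 (lift ord0 ord0)) @^-1` (~` [set 0]) `&`
   (fun v : 'rV[R]_m.+2 => `|sin (pi * (h%:R * ratio v))|) @^-1` `]-oo, d[).
  apply: measurableI; rewrite -[X in measurable X]setTI; last exact: ms.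
  by apply: measurable_coord => //; exact: measurableC.
by apply/seteqP; split => v /=; rewrite in_itv/= => -[/eqP ? ?].
Qed.

Lemma inner_rVcons (R : realType) n (t : R) (w : 'rV[R]_n) :
  inner (rVcons (t, w)) (rVcons (t, w)) = t ^+ 2 + inner w w.
Proof.
rewrite /inner big_ord_recl !mxE unlift_none/= -expr2; congr (_ + _).
by apply: eq_bigr => i _; rewrite !mxE liftK.
Qed.

Lemma coord_le1 (R : realType) n (w : 'rV[R]_n) i : enorm w <= 1 -> `|w ord0 i| <= 1.
Proof.
rewrite enorm_le1 => w1; rewrite -(ler_pXn2r (n := 2)) ?nnegrE// expr1n real_normK ?num_real//.
apply: le_trans w1; rewrite /inner (bigD1 i)//= -expr2 lerDl.
by apply: sumr_ge0 => j _; rewrite -expr2 sqr_ge0.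
Qed.

(** Uniqueness of the product measure permits integrating the new first coordinate [t] on the
    inside. *)
Lemma lebesgue_rVSE (R : realType) n (A : set 'rV[R]_n.+1) : measurable A ->
  lebesgue_rV R n.+1 A =
  (\int[lebesgue_rV R n]_w lebesgue_measure [set t | A (rVcons (t, w))])%E.
Proof.
move=> mA.
have mX : measurable (@rVcons R n @^-1` A).
  by rewrite -[X in measurable X]setTI; exact: measurable_rVcons.
transitivity ((lebesgue_measure \x lebesgue_rV R n)%E (@rVcons R n @^-1` A)) => //.
rewrite (@product_measure_unique _ _ _ _ _ _ _ (lebesgue_measure \x^ lebesgue_rV R n)%E)//.
  apply: eq_integral => w _; rewrite /=; congr (lebesgue_measure _).
  by apply/seteqP; split => t; rewrite /ysection/= inE.
by move=> X Y mX' mY; exact: product_measure2E.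
Qed.

(** With the other coordinates [w] fixed, [h] times the ratio is linear in the first coordinate with
    slope [l = h / w_0], so the resonant values form a slab over [[-|l|, |l|]]. As
    [|w_0| <= 1 <= h], [|l| >= 1] and [(2 |l| + 3) * 4 d / |l| <= 20 d], uniformly in [h]. *)
Lemma lebesgue_near_resonance_le (R : realType) m h (d : R) : (0 < h)%N -> 0 < d ->
  (lebesgue_rV R m.+2 (near_resonance h d `&` unit_ball R m.+2) <=
   (20 * d)%:E * lebesgue_rV R m.+1 (unit_ball R m.+1))%E.
Proof.
move=> h0 d0; have mB := @measurable_unit_ball R m.+1.
rewrite lebesgue_rVSE; last first.
  by apply: measurableI; [exact: measurable_near_resonance|exact: measurable_unit_ball].
apply: (@le_trans _ _ (\int[lebesgue_rV R m.+1]_w ((20 * d)%:E * (\1_(unit_ball R m.+1) w)%:E))%E).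
  apply: ge0_le_integral_nonmeasurable => w _; first exact: measure_ge0.
  set S := [set t | _].
  have SB t : S t -> enorm w <= 1 /\ `|t| <= 1.
    move=> [_]; rewrite /unit_ball /= => tw; split.
      move: tw; rewrite !enorm_le1 inner_rVcons => tw.
      by apply: le_trans tw; rewrite lerDr sqr_ge0.
    by have := coord_le1 ord0 tw; rewrite mxE unlift_none.
  have [wB|wB] := boolP (enorm w <= 1); last first.
    rewrite (_ : S = set0) ?measure0.
      by rewrite mule_ge0// lee_fin// mulr_ge0// ltW.
    by apply/seteqP; split => // t /SB[wB']; rewrite wB' in wB.
  rewrite indicE mem_set// mule1.
  have [w0|w0] := eqVneq (w ord0 ord0) 0.
    rewrite (_ : S = set0) ?measure0 ?lee_fin ?mulr_ge0// ?ltW//.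
    by apply/seteqP; split => // t [[]]; rewrite mxE liftK/= w0 eqxx.
  pose l := h%:R / w ord0 ord0.
  have w1 := coord_le1 ord0 wB.
  have nw0 : 0 < `|w ord0 ord0| by rewrite normr_gt0.
  have l1 : 1 <= `|l|.
    rewrite /l normrM normfV ger0_norm// ler_pdivlMr// mul1r.
    by apply: le_trans w1 _; rewrite ler1n.
  have l0 : l != 0 by rewrite -normr_gt0 (lt_le_trans _ l1).
  have SE : S `<=` slab l 0 (- `|l|) `|l| d.
    move=> t St; have [_ t1] := SB _ St; case: St => -[_].
    rewrite /ratio !mxE unlift_none liftK/=.
    rewrite (_ : h%:R * _ = l * t + 0); last by rewrite addr0 /l mulrAC mulrA.
    move=> sd _; split=> //.
    have : `|l * t| <= `|l| by rewrite normrM -[leRHS]mulr1 ler_wpM2l.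
    by rewrite ler_norml addr0.
  have mS : measurable S.
    have mX : measurable (@rVcons R m.+1 @^-1` (near_resonance h d `&` unit_ball R m.+2)).
      rewrite -[X in measurable X]setTI; apply: measurable_rVcons => //.
      apply: measurableI; [exact: measurable_near_resonance|exact: measurable_unit_ball].
    have := measurable_ysection w mX; congr measurable.
    by apply/seteqP; split => t; rewrite /ysection/= inE.
  apply: (@le_trans _ _ (lebesgue_measure (slab l 0 (- `|l|) `|l| d))).
    by apply: le_measure => //; rewrite inE//; exact: measurable_slab.
  apply: le_trans (lebesgue_slab_le _ l0 d0 _) _; first by lra.
  rewrite lee_fin mulrA ler_pdivrMr; last by lra.
  by nra.
rewrite ge0_integralZl_EFin//.
- by rewrite integral_indic// setIT.
- by apply/measurable_EFinP.
- by rewrite mulr_ge0// ltW.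
Qed.

(** [ratio] is invariant under scaling, so the preimage of the set under [direction] lies in the set
    itself, and the estimate in the ball passes to the sphere. [C] is 20 times a quotient of ball
    volumes. *)
Lemma sphere_unif_near_resonance_le (R : realType) m :
  exists2 C : R, 0 <= C & forall h (d : R), (0 < h)%N -> 0 < d ->
    (sphere_unif R m.+2 (near_resonance h d) <= (C * d)%:E)%E.
Proof.
have B0 := lebesgue_unit_ball_gt0 R m.+2; have Boo := lebesgue_unit_ball_lty R m.+2.
have B'oo := lebesgue_unit_ball_lty R m.+1.
have mB := @measurable_unit_ball R m.+2.
exists (20 * fine (lebesgue_rV R m.+1 (unit_ball R m.+1)) /
    fine (lebesgue_rV R m.+2 (unit_ball R m.+2))).
  by rewrite divr_ge0 ?mulr_ge0 ?fine_ge0.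
move=> h d h0 d0; have mA := @measurable_near_resonance R m h d.
have mD : measurable (@direction R m.+2 @^-1` near_resonance h d).
  by rewrite -[X in measurable X]setTI; exact: measurable_direction.
have := lebesgue_near_resonance_le m h0 d0.
have sub : @direction R m.+2 @^-1` near_resonance h d `<=` near_resonance h d.
  move=> v /=; rewrite /near_resonance /= /ratio !mxE mulf_eq0 negb_or.
  by move=> -[/andP[n0 v1]]; rewrite -mulf_div divff// mul1r.
have : (lebesgue_rV R m.+2 (@direction R m.+2 @^-1` near_resonance h d `&` unit_ball R m.+2) <=
   lebesgue_rV R m.+2 (near_resonance h d `&` unit_ball R m.+2))%E.
  by apply: le_measure; rewrite ?inE; [exact: measurableI|exact: measurableI|exact: setSI].
move=> /le_trans /[apply] le_ball.
pose P : probability 'rV[R]_m.+2 R :=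
  mnormalize (mrestr (lebesgue_rV R m.+2) (@measurable_unit_ball R m.+2))
    \d_(0 : 'rV[R]_m.+2).
rewrite [leLHS](_ : _ = P (@direction R m.+2 @^-1` near_resonance h d))//.
have b0 : (0 <= lebesgue_rV R m.+1 (unit_ball R m.+1))%E by [].
move: B0 Boo B'oo le_ball b0; rewrite /P; move: (lebesgue_rV R m.+2) => L.
move: (lebesgue_rV R m.+1 _) => b.
rewrite /= /mnormalize /= /mrestr setTI => B0 Boo boo le_ball b0.
rewrite gt_eqF//= lt_eqF//=.
have LB : 0 < fine (L (unit_ball R m.+2)) by apply: fine_gt0; rewrite B0 Boo.
rewrite muleC -lee_pdivlMl ?invr_gt0// invrK -EFinM.
apply: le_trans le_ball _; rewrite -(@fineK _ b) ?ge0_fin_numE// -EFinM lee_fin.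
rewrite le_eqVlt; apply/orP; left; apply/eqP.
by rewrite fineK ?ge0_fin_numE//; field; rewrite gt_eqF.
Qed.

(** * Averaging over the directions *)

Lemma wasserstein1_ge0 d (T : measurableType d) (R : realType) (dist : T -> T -> R)
    (mu nu : set T -> \bar R) :
  (forall x y, 0 <= dist x y) -> (0 <= wasserstein1 dist mu nu)%E.
Proof.
move=> dist0; apply: le_ereal_inf_tmp => _ [g _ <-].
by apply: integral_ge0 => p _; rewrite lee_fin.
Qed.

(** The layers are indicators of [near_resonance h (2^-j)]. Their weight [2^j] cancels against the
    probability [C 2^-j], so each pair [(h, j)] costs a multiple of [1 / h]; the [J] layers and the
    harmonic sum of order [J] give the square. *)
Lemma SW11_cells_le (R : realType) m : exists2 C : R, 0 < C & forall J,
  (SW11 (cell_source R m (2 ^ J)) (cell_target R m (2 ^ J)) <=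
   (C * (J%:R + 1) ^+ 2 / 2 ^+ J)%:E)%E.
Proof.
have [C C0 CP] := sphere_unif_near_resonance_le R m.
(* Since [Hm <= 1 + 2 J], the final numerator is at most [33 + 32 J + 6 C J (1 + 2 J)]. *)
exists (33 + 12 * C); first by lra.
move=> J; set n : R := 2 ^+ J; pose H := (2 ^ (2 * J))%N.
have n0 : 0 < n by rewrite exprn_gt0.
have nE : (2 ^ J)%:R = n by rewrite natrX.
pose Hm : R := \sum_(h < H) h.+1%:R^-1.
have HmJ : Hm <= 1 + 2 * J%:R by have := harmonic_le R (2 * J); rewrite natrM.
have Hm0 : 0 <= Hm by apply: sumr_ge0.
pose N (p : 'I_H * 'I_J) : set 'rV[R]_m.+2 := near_resonance p.1.+1 (2 ^- p.2).
pose A (i : option ('I_H * 'I_J)) := if i is Some p then N p else setT.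
pose c (i : option ('I_H * 'I_J)) : R := if i is Some p
  then 6 * (2 / p.1.+1%:R * 2 ^+ p.2) / (2 * n)
  else (54 + 40 * J%:R + 12 * Hm) / (2 * n).
pose r := None :: [seq Some p | p <- index_enum ('I_H * 'I_J)%type].
have c0 i : 0 <= c i.
  case: i => [p|]; rewrite /c divr_ge0 ?(mulr_ge0 _ (ltW n0))//.
  by rewrite !addr_ge0// mulr_ge0.
have mA i : measurable (A i).
  by case: i => [p|]; [exact: measurable_near_resonance|exact: measurableT].
pose F v : R := \sum_(i <- r) c i * \1_(A i) v.
have F0 v : 0 <= F v by apply: sumr_ge0 => i _; rewrite mulr_ge0.
have W1F v : unit_sphere R m.+2 v ->
    (W1_line (pushforward (cell_source R m (2 ^ J)) (inner v))
       (pushforward (cell_target R m (2 ^ J)) (inner v)) <= (F v)%:E)%E.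
  rewrite /unit_sphere/= => v1; have n0' : (0 < 2 ^ J)%N by rewrite expn_gt0.
  have [a0|a0] := eqVneq (v ord0 (lift ord0 ord0)) 0.
    by apply: le_trans (W1_line_cells0 n0' a0) _; rewrite lee_fin.
  apply: le_trans (W1_line_cells_le _ a0 _ _) _; rewrite ?coord_le1 ?v1//.
  have -> : layer_series J (v ord0 ord0 / v ord0 (lift ord0 ord0)) =
      2 * Hm + \sum_(p : 'I_H * 'I_J) 2 / p.1.+1%:R * 2 ^+ p.2 * \1_(N p) v.
    rewrite /layer_series /Hm mulr_sumr.
    rewrite -(pair_bigA _ (fun (h : 'I_H) (j : 'I_J) =>
       2 / h.+1%:R * 2 ^+ j * \1_(N (h, j)) v))/= -big_split/=.
    apply: eq_bigr => h _; rewrite /layers mulrDr mulr1 mulr_sumr; congr (_ + _).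
    apply: eq_bigr => j _; rewrite -[RHS]mulrA; congr (_ * (_ * _)).
    rewrite indicE; congr (_%:R); congr nat_of_bool.
    by apply/idP/idP => [sd|]; [rewrite inE|rewrite inE => -[]].
  rewrite lee_fin nE /F big_cons big_map /= indicT /=.
  rewrite le_eqVlt; apply/orP; left; apply/eqP.
  rewrite (_ : \sum_(p : 'I_H * 'I_J) c (Some p) * \1_(N p) v =
    6 * (\sum_(p : 'I_H * 'I_J) 2 / p.1.+1%:R * 2 ^+ p.2 * \1_(N p) v) / (2 * n)); last first.
    rewrite mulr_sumr mulr_suml; apply: eq_bigr => p _; rewrite /c.
    by ring.
  by field; rewrite gt_eqF.
apply: (@le_trans _ _ (\int[sphere_unif R m.+2]_v (F v)%:E)%E).
  rewrite /SW11; apply: (@le_trans _ _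
      (\int[sphere_unif R m.+2]_(v in unit_sphere R m.+2) (F v)%:E)%E).
    by apply: ge0_le_integral_nonmeasurable => v vS; [exact: wasserstein1_ge0|exact: W1F].
  apply: ge0_subset_integral => //; last by move=> v _; rewrite lee_fin.
  - exact: measurable_unit_sphere.
  - by apply/measurable_EFinP; apply: measurable_sum => i; exact: measurable_funM.
have P1 : sphere_unif R m.+2 (A None) = 1%E by exact: probability_setT.
rewrite integral_sum_indic// big_cons big_map [X in (_ * X + _)%E]P1 mule1.
apply: (@le_trans _ _ ((c None)%:E + \sum_(p : 'I_H * 'I_J)
    (6 * (2 / p.1.+1%:R) * C / (2 * n))%:E)%E).
  apply: leeD => //; apply: lee_sum => p _.
  have e0 : 0 < 2 ^- p.2 :> R by rewrite invr_gt0 exprn_gt0.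
  apply: le_trans (lee_wpmul2l _ (CP _ _ _ e0)) _ => //; first by rewrite lee_fin.
  rewrite -EFinM lee_fin /c le_eqVlt; apply/orP; left; apply/eqP.
  by field; rewrite !gt_eqF// exprn_gt0.
rewrite sumEFin -EFinD lee_fin.
rewrite -(pair_bigA _ (fun (h : 'I_H) (j : 'I_J) => 6 * (2 / h.+1%:R) * C / (2 * n)))/=.
under eq_bigr => h _ do rewrite sumr_const card_ord.
have -> : \sum_(h < H) (6 * (2 / h.+1%:R) * C / (2 * n)) *+ J =
    6 * C * J%:R * Hm / n.
  rewrite /Hm mulr_sumr mulr_suml; apply: eq_bigr => h _.
  by rewrite -[_ *+ J]mulr_natr; field; rewrite gt_eqF//= pnatr_eq0.
have J0 : 0 <= J%:R :> R by [].
rewrite /c (_ : _ + _ = (27 + 20 * J%:R + 6 * Hm + 6 * C * J%:R * Hm) / n); last first.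
  by field; rewrite gt_eqF.
rewrite ler_wpM2r ?invr_ge0 ?(ltW n0)//.
have CJ : 0 <= C * J%:R by rewrite mulr_ge0.
have : C * J%:R * Hm <= C * J%:R * (1 + 2 * J%:R) by rewrite ler_wpM2l.
nra.
Qed.

(** * Support, complexity and transport cost *)

Lemma measurable_set1_rV (R : realType) n (v : 'rV[R]_n) : measurable [set v].
Proof.
rewrite (_ : [set v] = \bigcap_i ((fun w : 'rV[R]_n => w ord0 i) @^-1` [set v ord0 i])).
  apply: fin_bigcap_measurable => // i _.
  by rewrite -[X in measurable X]setTI; apply: measurable_coord.
apply/seteqP; split => [w -> //|w wv]; apply/rowP => i.
exact: (wv i Logic.I).
Qed.

Lemma measurable_seq d (T : measurableType d) (s : seq T) :
  (forall x : T, measurable [set x]) -> measurable [set` s].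
Proof.
move=> m1; elim: s => [|x s IH]; first by rewrite set_nil.
rewrite (_ : [set` x :: s] = [set x] `|` [set` s]); first exact: measurableU.
by apply/seteqP; split => y /=; rewrite inE => /predU1P.
Qed.

Lemma atoms_setC d (T : measurableType d) (R : realType) (s : seq T) (A : set T) :
  s != [::] -> [set` s] `<=` A -> atoms R s (~` A) = 0%E.
Proof.
move=> s0 sA; rewrite atomsE// big_seq big1 ?mul0r// => x xs.
by rewrite memNset// => /(_ _); apply; exact: sA.
Qed.

Lemma ae_atoms d (T : measurableType d) (R : realType) (s : seq T) (P : T -> Prop) :
  s != [::] -> (forall x : T, measurable [set x]) -> {in s, forall x, P x} ->
  {ae atoms R s, forall x, P x}.
Proof.
move=> s0 m1 sP; exists (~` [set` s]); split.
- by apply: measurableC; exact: measurable_seq.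
- exact: atoms_setC.
- by move=> x /= nP /= xs; apply: nP; exact: sP.
Qed.

Lemma ae_atomsP d (T : measurableType d) (R : realType) (s : seq T) (P : T -> Prop) x :
  {ae atoms R s, forall x, P x} -> x \in s -> P x.
Proof.
move=> [N [mN N0 PN]] xs; apply: contrapT => nP.
by have := @atoms_gt0 _ _ R _ _ _ xs (PN _ nP); rewrite [X in (_ < X)%E]N0 ltxx.
Qed.

Lemma supp_atoms (R : realType) m (s : seq 'rV[R]_m.+1) : s != [::] ->
  supp (atoms R s) = [set` s].
Proof.
move=> s0; apply/seteqP; split => [x /= xs|x /= xs U _ Ux]; last exact: atoms_gt0 Ux.
apply/negPn/negP => xNs.
have : (0 < atoms R s (~` [set` s]))%E.
  apply: xs; last exact/negP.
  apply: closed_openC; apply: (accessible_finite_set_closed.1 _) (finite_seq s).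
  by apply: hausdorff_accessible; exact: norm_hausdorff.
by rewrite [X in (_ < X)%E]atoms_setC ?ltxx.
Qed.

(** The second components of [cell_pairs] list every grid point twice; this list has no repetition,
    so a sum over the support is a sum over it. *)
Definition lattice_square (R : realType) m n : seq 'rV[R]_m.+2 :=
  [seq lattice_point m j%:R k%:R | k <- iota 0 n, j <- iota 0 n].

Lemma lattice_squareP (R : realType) m n (y : 'rV[R]_m.+2) :
  reflect (exists j k : 'I_n, y = lattice_point m j%:R k%:R) (y \in lattice_square R m n).
Proof.
apply: (iffP allpairsP) => [[[k j] /= [+ + ->]]|[j [k ->]]].
  by rewrite !mem_iota/= => kn jn; exists (Ordinal jn), (Ordinal kn).
by exists (nat_of_ord k, nat_of_ord j); rewrite !mem_iota/= !ltn_ord.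
Qed.

Lemma uniq_lattice_square (R : realType) m n : uniq (lattice_square R m n).
Proof.
apply: allpairs_uniq; rewrite ?iota_uniq// => -[k j] [k' j'] _ _ /= /rowP E.
have := E ord0; have := E (lift ord0 ord0); rewrite !mxE/=.
by move=> /eqP; rewrite eqr_nat => /eqP -> /eqP; rewrite eqr_nat => /eqP ->.
Qed.

Lemma sum_lattice_square (R : realType) m n (V : nmodType) (F : 'rV[R]_m.+2 -> V) :
  \sum_(y <- lattice_square R m n) F y =
  \sum_(k < n) \sum_(j < n) F (lattice_point m j%:R k%:R).
Proof.
have iE (G : nat -> V) : \sum_(k <- iota 0 n) G k = \sum_(k < n) G k.
  by rewrite -(big_mkord xpredT G)/= /index_iota subn0.
by rewrite big_allpairs_dep/= iE; apply: eq_bigr => k _; rewrite iE.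
Qed.

Lemma cell_pairsP (R : realType) m n (p : 'rV[R]_m.+2 * 'rV[R]_m.+2) :
  reflect (exists (j k : 'I_n) (b : bool), p =
      (lattice_point m (j%:R + (-1) ^+ b / 2) k%:R, lattice_point m j%:R k%:R))
    (p \in cell_pairs R m n).
Proof.
rewrite mem_cat; apply: (iffP orP) => [[] /allpairsP[[k j] /= [+ + ->]]|].
- by rewrite !mem_iota/= => kn jn; exists (Ordinal jn), (Ordinal kn), false; rewrite expr0 mul1r.
- by rewrite !mem_iota/= => kn jn; exists (Ordinal jn), (Ordinal kn), true; rewrite expr1 mulN1r.
move=> [j [k [[] ->]]]; [right|left]; apply/allpairsP; exists (nat_of_ord k, nat_of_ord j);
  by rewrite !mem_iota/= !ltn_ord ?expr1 ?mulN1r ?expr0 ?mul1r.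
Qed.

Lemma supp_cell_target (R : realType) m n : (0 < n)%N ->
  supp (cell_target R m n) = [set` lattice_square R m n].
Proof.
move=> n0; rewrite supp_atoms; last first.
  by have := cell_pairs_neq0 R m n0; case: (cell_pairs R m n).
apply/seteqP; split => y /=.
  move=> /mapP[p /cell_pairsP[j [k [b ->]]] ->].
  by apply/lattice_squareP; exists j, k.
move=> /lattice_squareP[j [k ->]]; apply/mapP.
exists (lattice_point m (j%:R + (-1) ^+ false / 2) k%:R, lattice_point m j%:R k%:R) => //.
by apply/cell_pairsP; exists j, k, false.
Qed.

Lemma enorm_lattice_point_ge (R : realType) m (x y : R) :
  `|x| <= enorm (lattice_point m x y) /\ `|y| <= enorm (lattice_point m x y).
Proof.
rewrite enorm_lattice_point -!sqrtr_sqr.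
by rewrite !ler_sqrt ?addr_ge0 ?sqr_ge0// lerDl lerDr !sqr_ge0.
Qed.

Lemma enorm_lattice_point_le (R : realType) m (x y : R) :
  enorm (lattice_point m x y) <= `|x| + `|y|.
Proof.
have xy0 : 0 <= `|x| + `|y| by rewrite addr_ge0.
rewrite enorm_lattice_point -(ger0_norm xy0) -sqrtr_sqr ler_sqrt ?sqr_ge0//.
rewrite -(real_normK (num_real x)) -(real_normK (num_real y)).
have := normr_ge0 x; have := normr_ge0 y; nra.
Qed.

Definition natdist (i j : nat) := ((i - j) + (j - i))%N.

Lemma natdistE (R : realType) i j : (natdist i j)%:R = `|i%:R - j%:R| :> R.
Proof.
rewrite /natdist; have [ij|ji] := leqP i j.
  rewrite (eqP ij) add0n distrC ger0_norm ?subr_ge0 ?ler_nat// natrB//.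
rewrite (eqP (ltnW ji)) addn0 ger0_norm ?subr_ge0 ?ler_nat ?(ltnW ji)// natrB//.
exact: ltnW.
Qed.

(** If [i] and [j] differ by [p >= 1], the distance is at least [p - 1/2 >= (p + 1) / 4]; if they
    agree, it is exactly 1/2. *)
Lemma half_shift_ge (R : realType) (i j : nat) (b : bool) :
  (natdist i j).+1%:R / 4 <= `|i%:R + (-1) ^+ b / 2 - j%:R| :> R /\
  2^-1 <= `|i%:R + (-1) ^+ b / 2 - j%:R| :> R.
Proof.
rewrite -natr1 natdistE; set e := _ / 2.
have e12 : `|e| = 2^-1 by rewrite normrM normrX normrN1 expr1n mul1r ger0_norm.
have [ei ie] : - 2^-1 <= e /\ e <= 2^-1 by apply/andP; rewrite -ler_norml e12.
have [ij|ji|->] := ltngtP i j; last first.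
- by rewrite subrr normr0 addrAC subrr !add0r e12; split=> //; lra.
- have ij1 : j%:R + 1 <= i%:R :> R by rewrite natr1 ler_nat.
  by rewrite !ger0_norm; [split|..]; lra.
- have ij1 : i%:R + 1 <= j%:R :> R by rewrite natr1 ler_nat.
  by rewrite !ler0_norm; [split|..]; lra.
Qed.

(** Each distance to [j] occurs at most twice, once on either side. *)
Lemma sum_natdist_le (R : realType) n j (f : nat -> R) : (j < n)%N ->
  (forall i, 0 <= f i) -> \sum_(i < n) f (natdist j i) <= 2 * \sum_(i < n) f i.
Proof.
move=> jn f0; rewrite -(big_mkord xpredT (fun i => f (natdist j i))).
rewrite (big_cat_nat (n := j))//=; last exact: ltnW.
have sub k : (k <= n)%N -> \sum_(i < k) f i <= \sum_(i < n) f i.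
  move=> kn; rewrite (big_ord_widen n _ kn) [leRHS](bigID (fun i : 'I_n => (i < k)%N))/=.
  by rewrite lerDl sumr_ge0.
rewrite mulr_natl mulr2n; apply: lerD.
  apply: le_trans (sub j.+1 jn); rewrite big_mkord big_ord_recl.
  rewrite (reindex_inj rev_ord_inj)/=; apply: ler_wpDl => //.
  apply: ler_sum => i _; rewrite /bump/= add1n /natdist.
  by have ij := ltn_ord i; rewrite le_eqVlt; apply/orP; left; apply/eqP; congr f; lia.
apply: le_trans (sub (n - j)%N (leq_subr _ _)).
rewrite -{1}(add0n j) big_addn big_mkord le_eqVlt; apply/orP; left; apply/eqP.
by apply: eq_bigr => i _; congr f; rewrite /natdist; lia.
Qed.

(** Enlarging the square by one adds a row and a column of [n] terms at most [1 / (n + 1)], and a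
    corner: at most 3 in all. *)
Lemma sum_inv_le (R : realType) n :
  \sum_(p < n) \sum_(q < n) (p + q).+1%:R^-1 <= 3 * n%:R :> R.
Proof.
elim: n => [|n IH]; first by rewrite big_ord0 mulr0.
have row (g : nat -> nat) : (forall p, n <= g p)%N ->
    \sum_(p < n) (g p).+1%:R^-1 <= 1 :> R.
  move=> gn; apply: (@le_trans _ _ (\sum_(p < n) n.+1%:R^-1)).
    apply: ler_sum => p _; rewrite lef_pV2 ?posrE ?ltr0n//.
    by rewrite ler_nat ltnS.
  by rewrite sumr_const card_ord -[_ *+ n]mulr_natr mulrC ler_pdivrMr ?ltr0n// mul1r ler_nat.
rewrite big_ord_recr/= (eq_bigr (fun p : 'I_n =>
  \sum_(q < n) (p + q).+1%:R^-1 + (p + n).+1%:R^-1)); last first.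
  by move=> p _; rewrite big_ord_recr.
rewrite big_split/= big_ord_recr/= -(natr1 n).
have := row (fun p => p + n)%N (fun p => leq_addl _ _).
have := row (fun p => n + p)%N (fun p => leq_addr _ _).
have : (n + n).+1%:R^-1 <= 1 :> R by rewrite invf_le1 ?ltr0n// ler1n.
move=> h1 h2 h3; apply: le_trans (lerD (lerD IH h3) (lerD h2 h1)) _; lra.
Qed.

Lemma enorm_cell_pair (R : realType) m (x y : R) (b : bool) :
  enorm (lattice_point m (x + (-1) ^+ b / 2) y - lattice_point m x y) = 2^-1.
Proof.
rewrite lattice_pointB enorm_lattice_point subrr expr0n addr0 addrAC subrr add0r.
by rewrite sqrtr_sqr normrM normrX normrN1 expr1n mul1r ger0_norm.
Qed.

Lemma enorm_cell_ge (R : realType) m (j k i l : nat) (b : bool) :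
  2^-1 <= enorm (lattice_point m (j%:R + (-1) ^+ b / 2) k%:R -
                 lattice_point m i%:R l%:R) :> R.
Proof.
rewrite lattice_pointB; apply: le_trans (enorm_lattice_point_ge _ _ _).1.
by have [] := half_shift_ge R j i b.
Qed.

Lemma dist_to_cell (R : realType) m n (j k : 'I_n) (b : bool) :
  dist_to (lattice_point m (j%:R + (-1) ^+ b / 2) k%:R) [set` lattice_square R m n] = 2^-1.
Proof.
rewrite /dist_to; set A := [set _ | _ in _].
have lb : lbound A 2^-1.
  move=> _ [y /= /lattice_squareP[i [l ->]] <-]; exact: enorm_cell_ge.
have A2 : A 2^-1.
  exists (lattice_point m j%:R k%:R); last exact: enorm_cell_pair.
  by apply/lattice_squareP; exists j, k.
apply/le_anti/andP; split; first by apply: ge_inf => //; exists 2^-1.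
by apply: lb_le_inf => //; exists 2^-1.
Qed.

(** Below: [n^2] distances, each at most [3n]. Above: the distance is at least an eighth of one plus
    the index differences along both axes; folding each axis costs a factor 2, and [sum_inv_le]
    gives [8 * 4 * 3n = 96n]. *)
Lemma sum_inv_enorm_cell (R : realType) m n (j k : 'I_n) (b : bool)
    (x := lattice_point m (j%:R + (-1) ^+ b / 2) k%:R : 'rV[R]_m.+2) :
  n%:R / 3 <= \sum_(y <- lattice_square R m n) (enorm (x - y))^-1 <= 96 * n%:R.
Proof.
rewrite sum_lattice_square.
have n0 : (0 < n)%N := leq_ltn_trans (leq0n j) (ltn_ord j).
have pos (i l : nat) : 0 < enorm (x - lattice_point m i%:R l%:R).
  by apply: lt_le_trans (enorm_cell_ge _ _ _ _ _ _ b); rewrite invr_gt0.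
apply/andP; split.
  apply: (@le_trans _ _ (\sum_(l < n) \sum_(i < n) (3 * n%:R)^-1)).
    rewrite !sumr_const !card_ord -mulrnA -[_ *+ (n * n)]mulr_natr natrM.
    by rewrite le_eqVlt; apply/orP; left; apply/eqP; field; rewrite pnatr_eq0 -lt0n.
  apply: ler_sum => l _; apply: ler_sum => i _.
  rewrite lef_pV2 ?posrE ?mulr_gt0 ?ltr0n//.
  rewrite lattice_pointB; apply: le_trans (enorm_lattice_point_le _ _ _) _.
  rewrite -natdistE addrAC.
  apply: le_trans (lerD (ler_normD _ _) (lexx _)) _.
  rewrite -natdistE normrM normrX normrN1 expr1n mul1r ger0_norm//.
  have d1 : (natdist j i)%:R + 1 <= n%:R :> R.
    by rewrite natr1 ler_nat /natdist; have := ltn_ord j; have := ltn_ord i; lia.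
  have d2 : (natdist k l)%:R <= n%:R :> R.
    by rewrite ler_nat /natdist; have := ltn_ord k; have := ltn_ord l; lia.
  have nr : 0 <= n%:R :> R by [].
  by lra.
pose f (p q : nat) : R := (p + q).+1%:R^-1.
apply: (@le_trans _ _ (8 * \sum_(l < n) \sum_(i < n) f (natdist k l) (natdist j i))).
  rewrite mulr_sumr; apply: ler_sum => l _; rewrite mulr_sumr; apply: ler_sum => i _.
  rewrite /f -[8]invrK -invfM lef_pV2 ?posrE ?mulr_gt0 ?invr_gt0 ?ltr0n//.
  rewrite lattice_pointB -[(_ + _).+1%:R]natr1 natrD.
  have [h1 h2] :=
    enorm_lattice_point_ge m (j%:R + (-1) ^+ b / 2 - i%:R : R) (k%:R - l%:R).
  have [h3 _] := half_shift_ge R j i b.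
  have e0 : 0 <= (natdist k l)%:R :> R by [].
  move: h2 h3; rewrite -natdistE -[(natdist j i).+1%:R]natr1; lra.
apply: (@le_trans _ _ (8 * (4 * \sum_(p < n) \sum_(q < n) f p q))); last first.
  have := sum_inv_le R n; rewrite -/f; lra.
rewrite ler_wpM2l//.
apply: (@le_trans _ _ (\sum_(l < n) 2 * \sum_(q < n) f (natdist k l) q)).
  by apply: ler_sum => l _; apply: (sum_natdist_le (f := f (natdist k l))) => // q; rewrite invr_ge0.
rewrite -mulr_sumr (_ : 4 = 2 * 2)//; last by ring.
rewrite -mulrA ler_wpM2l//.
apply: (sum_natdist_le (f := fun p => \sum_(q < n) f p q)) => // p.
by apply: sumr_ge0 => q _; rewrite invr_ge0.
Qed.

Lemma cell_sourceP (R : realType) m n (x : 'rV[R]_m.+2) :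
  x \in [seq p.1 | p <- cell_pairs R m n] ->
  exists (j k : 'I_n) (b : bool), x = lattice_point m (j%:R + (-1) ^+ b / 2) k%:R.
Proof. by move=> /mapP[p /cell_pairsP[j [k [b ->]]] ->]; exists j, k, b. Qed.

Lemma cell_source_notin (R : realType) m n (x : 'rV[R]_m.+2) :
  x \in [seq p.1 | p <- cell_pairs R m n] -> x \notin lattice_square R m n.
Proof.
move=> /cell_sourceP[j [k [b ->]]]; apply/lattice_squareP => -[i [l E]].
have := enorm_cell_ge R m j k i l b; rewrite E subrr /enorm /inner big1.
  by rewrite sqrtr0 invr_le0 leNgt ltr0n.
by move=> q _; rewrite mxE mul0r.
Qed.

(** The source does not charge the grid, so the default value 1 is not taken. The distance 1/2
    halves the bounds of [sum_inv_enorm_cell], and one atom of the source bounds the essential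
    supremum from below. *)
Lemma complexity_cells (R : realType) m n : (0 < n)%N ->
  ((n%:R / 6)%:E <= complexity (cell_source R m n) (cell_target R m n) <= (48 * n%:R)%:E)%E.
Proof.
move=> n0; rewrite /complexity supp_cell_target//.
have s0 : [seq p.1 | p <- cell_pairs R m n] != [::].
  by have := cell_pairs_neq0 R m n0; case: (cell_pairs R m n).
have -> : cell_source R m n [set` lattice_square R m n] = 0%E.
  rewrite -[X in cell_source _ _ _ X]setCK atoms_setC// => x /=.
  by move=> /cell_source_notin /negP.
rewrite eqe eq_sym oner_eq0; set f := fun x => if _ then _ else _.
have fE x : x \in [seq p.1 | p <- cell_pairs R m n] ->
    exists2 r, f x = r%:E & n%:R / 6 <= r <= 48 * n%:R.
  move=> xs; have xN := cell_source_notin xs; have [j [k [b xE]]] := cell_sourceP xs.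
  exists (2^-1 * \sum_(y <- lattice_square R m n) (enorm (x - y))^-1).
    rewrite /f memNset; last exact/negP.
    by rewrite -fsbig_seq ?uniq_lattice_square// xE dist_to_cell.
  by have := sum_inv_enorm_cell R m j k b; rewrite -xE => /andP[? ?]; apply/andP; split; lra.
apply/andP; split.
  pose x0 := head 0 [seq p.1 | p <- cell_pairs R m n].
  have xs : x0 \in [seq p.1 | p <- cell_pairs R m n].
    by rewrite /x0; case: [seq _ | _ <- _] s0 => // *; rewrite /= mem_head.
  have := ae_atomsP (ess_sup_ge (cell_source R m n) f) xs.
  by have [r -> /andP[r1 _]] := fE _ xs; apply: le_trans; rewrite lee_fin.
apply/ess_supP; apply: ae_atoms => //; first exact: measurable_set1_rV.
by move=> x /fE[r -> /andP[_ r2]]; rewrite lee_fin.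
Qed.

Lemma coupling_setX_eq1 d (T : measurableType d) (R : realType)
    (mu nu : probability T R) (g : probability (T * T)%type R) (A B : set T) :
  couplings mu nu g -> measurable A -> measurable B ->
  mu (~` A) = 0%E -> nu (~` B) = 0%E -> g (A `*` B) = 1%E.
Proof.
move=> gc mA mB A0 B0.
have mAB : measurable (A `*` B) by exact: measurableX.
suff : g (~` (A `*` B)) = 0%E.
  rewrite probability_setC// => /eqP.
  by rewrite sube_eq ?fin_num_measure// add0e => /eqP.
apply: (@subset_measure0 _ _ _ g _ ((~` A) `*` setT `|` setT `*` (~` B))).
- exact: measurableC.
- by apply: measurableU; apply: measurableX => //; exact: measurableC.
- move=> [x y] /= nAB; have [Ax|Ax] := pselect (A x); [right|left]; split=> //=.
  by move=> By; apply: nAB.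
apply/eqP; rewrite eq_le measure_ge0 andbT.
apply: le_trans (measureU2 _ _ _) _; try by apply: measurableX => //; exact: measurableC.
have [gA _] := gc _ (measurableC mA); have [_ gB] := gc _ (measurableC mB).
by rewrite [X in (X + _)%E]gA [X in (_ + X)%E]gB A0 B0 adde0.
Qed.

(** Every coupling is concentrated on source points times grid points, where the cost is at least
    1/2. *)
Lemma W1_cells_ge (R : realType) m n : (0 < n)%N ->
  ((2^-1)%:E <= W1 (cell_source R m n) (cell_target R m n))%E.
Proof.
move=> n0; have p0 := cell_pairs_neq0 R m n0.
have q0 (f : 'rV[R]_m.+2 * 'rV[R]_m.+2 -> 'rV[R]_m.+2) :
    [seq f p | p <- cell_pairs R m n] != [::] by case: (cell_pairs R m n) p0.
apply: le_ereal_inf_tmp => _ [g gc <-].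
pose X := [set` [seq p.1 | p <- cell_pairs R m n]].
pose Y := [set` [seq p.2 | p <- cell_pairs R m n]].
have mX : measurable X by apply: measurable_seq; exact: measurable_set1_rV.
have mY : measurable Y by apply: measurable_seq; exact: measurable_set1_rV.
have gXY : g (X `*` Y) = 1%E.
  by apply: (coupling_setX_eq1 gc mX mY); rewrite atoms_setC ?q0.
apply: (@le_trans _ _ (\int[g]_p ((2^-1)%:E * (\1_(X `*` Y) p)%:E))%E).
  rewrite ge0_integralZl_EFin//; last first.
    by apply/measurable_EFinP; apply: measurable_indic; exact: measurableX.
  rewrite integral_indic//; last exact: measurableX.
  by rewrite setIT [X in (_ * X)%E]gXY mule1.
apply: ge0_le_integral_nonmeasurable => -[x y] _.
  by rewrite mule_ge0// lee_fin.
rewrite -EFinM lee_fin indicE; have [|] := boolP ((x, y) \in _); last first.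
  by rewrite mulr0 sqrtr_ge0.
rewrite mulr1 inE => -[/= /cell_sourceP[j [k [b ->]]] /mapP[p /cell_pairsP[i [l [c ->]]] ->]].
exact: enorm_cell_ge.
Qed.

(** * Choice of the scale and conclusion *)

Lemma dyadic_scale (R : realType) (K : R) : 1 <= K ->
  exists J, [/\ K <= 2 ^+ J, 2 ^+ J <= 2 * K & (J%:R + 1) * ln 2 <= 3 * ln (K + 1)].
Proof.
move=> K1; have K0 : 0 <= K by exact: le_trans K1.
pose N := Num.truncn K.
have /andP[NK KN] : N%:R <= K < N.+1%:R by apply: truncn_itv.
have N0 : (0 < N)%N by rewrite -ltnS -(ltr_nat R); exact: le_lt_trans K1 KN.
pose J := trunc_log 2 N.
have JN : (2 ^ J <= N)%N by apply: trunc_logP.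
have NJ : (N < 2 ^ J.+1)%N by apply: trunc_log_ltn.
have JK : 2 ^+ J <= K by apply: le_trans NK; rewrite -natrX ler_nat.
(* [2 ^ J] is the largest power of 2 not above the integer part of [K], so the next one lies between
   [K] and [2 K]. In the logarithmic bound, [J ln 2] and the two extra [ln 2] are each at most
   [ln (K + 1)]. *)
exists J.+1; split.
- by apply: le_trans (ltW KN) _; rewrite -natrX ler_nat.
- by rewrite exprS ler_wpM2l.
have ln_le (x y : R) : 0 < x -> x <= y -> ln x <= ln y.
  by move=> x0 xy; rewrite ler_ln// posrE// (lt_le_trans x0).
have : ln 2 <= ln (K + 1) by apply: ln_le => //; lra.
have : ln (2 ^+ J) <= ln (K + 1) by apply: ln_le; rewrite ?exprn_gt0//; lra.
by rewrite lnXn// -[_ *+ J]mulr_natr -natr1; lra.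
Qed.

Theorem theorem1p4 (R : realType) (d : nat) (hd : (2 <= d)%N) :
  exists c_d a_d A_d : R, [/\ 0 < c_d, 0 < a_d, 0 < A_d &
    forall K : R, 1 <= K ->
    exists nu mu : probability 'rV[R]_d R,
    [/\ finitely_supported nu,
        finite_first_moment mu,
        ((a_d * K)%:E <= complexity mu nu <= (A_d * K)%:E)%E,
        exists2 gamma : probability ('rV[R]_d * 'rV[R]_d)%type R,
          couplings mu nu gamma &
          {ae gamma, forall p, enorm (p.1 - p.2) = dist_to p.1 (supp nu)} &
        ((c_d * (K / (ln (K + 1)) ^+ d))%:E * SW11 mu nu <= W1 mu nu)%E]].
Proof.
case: d hd => [|[|m]]// _; have [C C0 SWC] := SW11_cells_le R m.
have l0 : 0 < ln 2 :> R by rewrite ln_gt0// ltr1n.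
(* [18 = 2 * 3^2]: the 3 is that of [dyadic_scale], and the 2 comes from [W1 >= 1/2]. The bounds
   [n / 6] and [48 n] on the complexity, with [K <= n <= 2 K], give [1 / 6] and [96]. *)
exists ((ln 2) ^+ m.+2 / (18 * C)), (6^-1), 96; split => //.
  by rewrite divr_gt0 ?exprn_gt0// mulr_gt0.
move=> K K1; have [J [KJ JK JL]] := dyadic_scale K1.
have n0 : (0 < 2 ^ J)%N by rewrite expn_gt0.
have p0 := cell_pairs_neq0 R m n0.
have q0 (f : 'rV[R]_m.+2 * 'rV[R]_m.+2 -> 'rV[R]_m.+2) :
    [seq f p | p <- cell_pairs R m (2 ^ J)] != [::] by case: (cell_pairs R m (2 ^ J)) p0.
exists (cell_target R m (2 ^ J)), (cell_source R m (2 ^ J)); split.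
- exists [set` [seq p.2 | p <- cell_pairs R m (2 ^ J)]]; first exact: finite_seq.
  exact: atoms_eq1.
- rewrite /finite_first_moment integral_atoms ?ltry//; first exact: measurable_enorm.
  by move=> x; exact: sqrtr_ge0.
- have /andP[h1 h2] := complexity_cells R m n0; rewrite natrX in h1 h2.
  apply/andP; split.
    by apply: le_trans h1; rewrite lee_fin mulrC ler_wpM2r.
  by apply: le_trans h2 _; rewrite lee_fin; lra.
- exists (atoms R (cell_pairs R m (2 ^ J))); first exact: couplings_atoms.
  apply: ae_atoms => //.
    move=> [x y].
    rewrite (_ : [set (x, y)] = [set x] `*` [set y]); last first.
      by apply/seteqP; split => -[? ?] /= [-> ->].
    by apply: measurableX; exact: measurable_set1_rV.
  move=> p /cell_pairsP[j [k [b ->]]] /=.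
  by rewrite supp_cell_target// dist_to_cell enorm_cell_pair.
have K0 : 0 < K by exact: lt_le_trans K1.
have lL : ln 2 <= ln (K + 1) by rewrite ler_ln ?posrE; lra.
have L0 : 0 < ln (K + 1) by exact: lt_le_trans lL.
apply: le_trans (W1_cells_ge R m n0); apply: le_trans (lee_wpmul2l _ (SWC J)) _.
  by rewrite lee_fin mulr_ge0// divr_ge0// ?exprn_ge0 ?mulr_ge0// ltW.
rewrite -EFinM lee_fin.
move: (ln 2) (ln (K + 1)) l0 L0 lL JL => l L l0 L0 lL JL.
have n0' : 0 < 2 ^+ J :> R by rewrite exprn_gt0.
(* Two of the [m + 2] logarithms absorb [(J + 1)^2]; the other [m] form powers of
   [ln 2 / ln (K + 1) <= 1]. *)
rewrite [leLHS](_ : _ = (l ^+ m / L ^+ m) * (((J%:R + 1) * l) ^+ 2 / L ^+ 2) * (K / 2 ^+ J) / 18);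
  last first.
  rewrite !(exprSr _ m.+1) !(exprSr _ m); field.
  by rewrite !gt_eqF ?exprn_gt0.
have x1 : l ^+ m / L ^+ m <= 1.
  by rewrite ler_pdivrMr ?exprn_gt0// mul1r lerXn2r// nnegrE ltW.
have y9 : ((J%:R + 1) * l) ^+ 2 / L ^+ 2 <= 9.
  rewrite ler_pdivrMr ?exprn_gt0// (_ : 9 * L ^+ 2 = (3 * L) ^+ 2); last by ring.
  by rewrite lerXn2r// nnegrE mulr_ge0// ?addr_ge0// ltW.
have z1 : K / 2 ^+ J <= 1 by rewrite ler_pdivrMr// mul1r.
rewrite ler_pdivrMr// (_ : 2^-1 * 18 = 1 * 9 * 1); last by field.
have lm0 : 0 <= l ^+ m / L ^+ m by rewrite divr_ge0// exprn_ge0// ltW.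
have jl0 : 0 <= ((J%:R + 1) * l) ^+ 2 / L ^+ 2 by rewrite divr_ge0// sqr_ge0.
have kj0 : 0 <= K / 2 ^+ J by rewrite divr_ge0// ltW.
by apply: ler_pM => //; [exact: mulr_ge0|exact: ler_pM].
Qed.
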